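(* Let $\mathbf{V}_{k,h}$ be either the Raviart-Thomas space of order $k\ge 0$ on the active mesh $\mathcal{T}_h$ (with $\hat k=k$) or the Brezzi-Douglas-Marini space of order $k\ge 1$ on $\mathcal{T}_h$ (with $\hat k=k-1$), and let $Q_{\hat k,h}$ be the space of discontinuous piecewise polynomials of degree at most $\hat k$ on $\mathcal{T}_h$. Assume that $\boldsymbol{u}_h\in \mathbf{V}_{k,h}$ satisfies $$\mathcal{B}_0(\boldsymbol{u}_h,q_h)=\int_{\Omega}(\operatorname{div}\boldsymbol{u}_h)\,q_h\,d\mathbf{x}+\sum_{F\in\mathcal{F}_h}\sum_{j=0}^{\hat k}\tau_b\,h^{2j+1}\big([\![D^j(\operatorname{div}\boldsymbol{u}_h)]\!],[\![D^jq_h]\!]\big)_F=0\qquad\text{for all } q_h\in Q_{\hat k,h}.$$ Then $\operatorname{div}\boldsymbol{u}_h=0$ (in the active domain $\Omega_{\mathcal{T}_h}$, on which $\boldsymbol{u}_h$ is defined).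
   Context: Domain and mesh. $\Omega\subset\mathbb{R}^2$ is an open bounded domain with piecewise smooth boundary $\partial\Omega$. $\Omega_0\supseteq\Omega$ is a computational domain with polygonal boundary, and $\{\mathcal{T}_{0,h}\}_h$ is a quasi-uniform family of simplicial (triangular) meshes of $\Omega_0$, so $\Omega_0=\bigcup_{T\in\mathcal{T}_{0,h}}T$. These meshes conform to $\partial\Omega_0$ but need not conform to $\partial\Omega$. $h$ is the piecewise constant function equal on $T\in\mathcal{T}_{0,h}$ to the diameter $h_T>0$ of $T$, with $\max_T h_T<h_0$ for a small $h_0\ll 1$. When $h$ appears on an edge it denotes a positive local mesh size there. The active mesh is $\mathcal{T}_h=\{T\in\mathcal{T}_{0,h}: |T\cap\Omega|>0\}$, where $|\cdot|$ is area, and the active domain is $\Omega_{\mathcal{T}_h}=\bigcup_{T\in\mathcal{T}_h}T$. The set of cut elements is $\mathcal{G}_h=\{T\in\mathcal{T}_h: |\partial\Omega\cap\overline{T}|>0\}$, where here $|\cdot|$ is length. $\mathcal{F}_h$ is the set of edges of elements in $\mathcal{G}_h$ that are shared by two elements of $\mathcal{T}_h$. It is assumed that $\partial\Omega$ intersects the boundary $\partial T$ of a (cut) element $T$ exactly twice and each open edge at most once. Spaces. $Q_m(T)$ denotes the polynomials on $T$ of degree at most $m$. $\mathbf{H}^{\operatorname{div}}(D)=\{\boldsymbol{v}\in L^2(D)^2:\operatorname{div}\boldsymbol{v}\in L^2(D)\}$. Define $$\mathbf{V}_{k,h}=\{\boldsymbol{v}_h\in\mathbf{H}^{\operatorname{div}}(\Omega_{\mathcal{T}_h}):\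 \boldsymbol{v}_h|_T\in\mathbf{V}_k(T)\ \forall T\in\mathcal{T}_h\},\qquad Q_{\hat k,h}=\bigoplus_{T\in\mathcal{T}_h}Q_{\hat k}(T),$$ where either $\mathbf{V}_k(T)=\mathbf{RT}_k(T)=Q_k(T)^2+\mathbf{x}\,Q_k(T)$ with $k\ge 0$ and $\hat k=k$, or $\mathbf{V}_k(T)=\mathbf{BDM}_k(T)=Q_k(T)^2$ with $k\ge 1$ and $\hat k=k-1$. Stabilization notation. $\tau_b>0$ is a constant. For a function $p$ on $\Omega_{\mathcal{T}_h}$ and an edge $F=\partial T\cap\partial T'$ shared by $T,T'\in\mathcal{T}_h$, the jump is $[\![p]\!]=(p|_T-p|_{T'})|_F$. $D^jp$ denotes the generalised derivative of order $j$ (taken elementwise; the collection of all partial derivatives of order $j$, with $D^0p=p$), and the jump of $D^jp$ is taken componentwise. $(\cdot,\cdot)_F$ is the $L^2(F)$ inner product. *)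

(* Defs.v *)
(* The plane is [R * R] with [R : realType].  The
   norm of [R * R] is the max norm, so Euclidean lengths are defined here. *)
From HB Require Import structures.
From mathcomp Require Import all_boot all_order all_algebra.
From mathcomp Require Import all_classical all_reals all_analysis.

Set Implicit Arguments.
Unset Strict Implicit.
Unset Printing Implicit Defensive.

Import Order.TTheory GRing.Theory Num.Theory.
Import numFieldNormedType.Exports.

Local Open Scope classical_set_scope.
Local Open Scope ring_scope.

Section Plane.
Context {R : realType}.
Implicit Types (x y a b : R * R) (A D K F : set (R * R)).

Local Notation area := (@lebesgue_measure R \x @lebesgue_measure R)%E.

Definition edist x y : R :=
  Num.sqrt ((x.1 - y.1) ^+ 2 + (x.2 - y.2) ^+ 2).

(* [0] is adjoined so that the empty set has diameter [0], not [-oo]. *)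
Definition ediam A : \bar R :=
  ereal_sup (0%E |` [set (edist xy.1 xy.2)%:E | xy in A `*` A]).

(* Length of a subset of the plane: one-dimensional Hausdorff measure. *)
Definition length_delta (delta : R) A : \bar R :=
  ereal_inf [set (\sum_(0 <= n <oo) ediam (U n))%E | U in
    [set U : nat -> set (R * R) | A `<=` \bigcup_n U n /\
                                  forall n, (ediam (U n) <= delta%:E)%E]].

Definition length1 A : \bar R :=
  ereal_sup [set length_delta delta A | delta in [set delta : R | 0 < delta]].

Definition bdry A : set (R * R) := closure A `\` A°.

Definition segment a b : set (R * R) :=
  [set (1 - t) *: a + t *: b | t in `[0, 1]].

(* A simple regular C^1 arc, parametrised over [0, 1]; the parametrisation is
   C^1 up to the endpoints, i.e. is the restriction of a C^1 map on R. *)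
Definition regular_arc (gamma : R -> R * R) : Prop :=
  [/\ forall t, derivable gamma t 1,
      continuous (derive1 gamma),
      forall t, 0 <= t <= 1 -> derive1 gamma t != 0 &
      forall s t, 0 <= s <= 1 -> 0 <= t <= 1 -> gamma s = gamma t -> s = t].

Definition arc (gamma : R -> R * R) : set (R * R) := gamma @` `[0, 1].

Definition arc_ends (gamma : R -> R * R) : set (R * R) :=
  [set gamma 0; gamma 1].

Definition piecewise_smooth_bdry A : Prop :=
  exists (n : nat) (gamma : 'I_n -> R -> R * R),
    [/\ forall l, regular_arc (gamma l),
        forall l m, l != m ->
          arc (gamma l) `&` arc (gamma m) `<=`
            arc_ends (gamma l) `&` arc_ends (gamma m) &
        bdry A = \bigcup_l arc (gamma l)].

Definition smooth_domain A : Prop :=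
  [/\ open A, A !=set0, connected A, bounded_set A & piecewise_smooth_bdry A].

(* [A] is the closed region, so connectedness is asked of its interior. *)
Definition polygonal_domain A : Prop :=
  connected (A°) /\
  exists s : seq ((R * R) * (R * R)),
    bdry A = \bigcup_(e in [set` s]) segment e.1 e.2.

Definition dx (f : R * R -> R) : R * R -> R :=
  fun x => 'D_((1, 0) : R * R) (f : R * R -> R^o) x.
Definition dy (f : R * R -> R) : R * R -> R :=
  fun x => 'D_((0, 1) : R * R) (f : R * R -> R^o) x.

Definition classical_div (v : R * R -> R * R) : R * R -> R :=
  fun x => dx (fun y => (v y).1) x + dy (fun y => (v y).2) x.

Fixpoint Cn (n : nat) (f : R * R -> R) : Prop :=
  continuous f /\
  if n is m.+1 then
    [/\ forall x, derivable (f : R * R -> R^o) x ((1, 0) : R * R),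
        forall x, derivable (f : R * R -> R^o) x ((0, 1) : R * R),
        Cn m (dx f) & Cn m (dy f)]
  else True.

Definition test_function D (phi : R * R -> R) : Prop :=
  (forall n, Cn n phi) /\
  exists K, [/\ compact K, K `<=` D & forall x, ~ K x -> phi x = 0].

Definition L2 D (f : R * R -> R) : Prop :=
  measurable_fun D f /\
  (\int[area]_(x in D)
     (f x ^+ 2)%:E < +oo)%E.

(* [g] is the (distributional) divergence of [v] on [D], and lies in L^2(D). *)
Definition is_L2_div D (v : R * R -> R * R) (g : R * R -> R) : Prop :=
  L2 D g /\
  forall phi, test_function D phi ->
    \int[area]_(x in D)
       ((v x).1 * dx phi x + (v x).2 * dy phi x) =
    - \int[area]_(x in D)
       (g x * phi x).

Definition Hdiv D (v : R * R -> R * R) : Prop :=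
  [/\ L2 D (fun x => (v x).1), L2 D (fun x => (v x).2) &
      exists g, is_L2_div D v g].

(* Restriction to [A] is a polynomial of total degree at most [m]. *)
Definition poly_on (m : nat) A (f : R * R -> R) : Prop :=
  exists c : nat -> nat -> R, forall x, A x ->
    f x = \sum_(i < m.+1) \sum_(j < m.+1 | (i + j <= m)%N)
            c i j * x.1 ^+ i * x.2 ^+ j.

End Plane.

Record mesh (R : realType) := Mesh {
  nelt : nat;
  vtx : 'I_nelt -> 'I_3 -> R * R }.

Section Meshes.
Context {R : realType}.
Implicit Types (M : mesh R) (Om : set (R * R)).

Local Notation area := (@lebesgue_measure R \x @lebesgue_measure R)%E.

Definition elem M (T : 'I_(nelt M)) : set (R * R) :=
  [set x | exists l : 'I_3 -> R,
    [/\ forall i, 0 <= l i, \sum_i l i = 1 & x = \sum_i l i *: vtx T i]].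

(* The (closed) edge of [T] opposite to its vertex [i]. *)
Definition edge M (T : 'I_(nelt M)) (i : 'I_3) : set (R * R) :=
  segment (vtx T (ordS i)) (vtx T (ord_pred i)).

Definition open_edge M (T : 'I_(nelt M)) (i : 'I_3) : set (R * R) :=
  edge T i `\` [set vtx T (ordS i); vtx T (ord_pred i)].

Definition nondegenerate M (T : 'I_(nelt M)) : Prop :=
  let a := vtx T 0 in
  let b := vtx T 1 - a in
  let c := vtx T 2 - a in
  b.1 * c.2 - b.2 * c.1 != 0.

Definition conforming M : Prop :=
  forall T T' : 'I_(nelt M), T != T' ->
    [\/ elem T `&` elem T' = set0,
        exists i i', elem T `&` elem T' = [set vtx T i] /\ vtx T i = vtx T' i' |
        exists i i', elem T `&` elem T' = edge T i /\ edge T i = edge T' i'].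

Definition triangulation M (Om0 : set (R * R)) : Prop :=
  [/\ forall T : 'I_(nelt M), nondegenerate T,
      conforming M &
      Om0 = \bigcup_(T in [set: 'I_(nelt M)]) elem T].

Definition hT M (T : 'I_(nelt M)) : R := fine (ediam (elem T)).

(* Every element contains a disc whose radius is comparable to the largest
   element diameter, uniformly over the family. *)
Definition quasi_uniform (I : Type) (Th : I -> mesh R) : Prop :=
  exists2 c : R, 0 < c &
    forall n (T T' : 'I_(nelt (Th n))),
      exists z, [set y | edist z y <= c * hT T'] `<=` elem T.

Definition active M Om (T : 'I_(nelt M)) : Prop :=
  (0 < area (elem T `&` Om))%E.

Definition active_domain M Om : set (R * R) :=
  \bigcup_(T in [set T : 'I_(nelt M) | active Om T]) elem T.

Definition active_interiors M Om : set (R * R) :=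
  \bigcup_(T in [set T : 'I_(nelt M) | active Om T]) (elem T)°.

Definition cut M Om (T : 'I_(nelt M)) : Prop :=
  active Om T /\ (0 < length1 (bdry Om `&` elem T))%E.

Definition cut_condition M Om : Prop :=
  forall T : 'I_(nelt M), cut Om T ->
    (exists a b, a != b /\ bdry Om `&` bdry (elem T) = [set a; b]) /\
    forall i, is_subset1 (bdry Om `&` open_edge T i).

(* The stabilised edges.  The edge shared by the elements [T] and [T'] is
   represented once, as the triple [(T, i, T')] with [T < T'] and
   [edge T i] = [edge T' i']. *)
Definition stab_edge M Om (e : 'I_(nelt M) * 'I_3 * 'I_(nelt M)) : Prop :=
  let: (T, i, T') := e in
  [/\ (T < T')%N, exists i', edge T i = edge T' i',
      active Om T, active Om T' & cut Om T \/ cut Om T'].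

Definition edge_set M (e : 'I_(nelt M) * 'I_3 * 'I_(nelt M)) : set (R * R) :=
  edge e.1.1 e.1.2.

(* Integral over an edge with respect to arc length. *)
Definition edge_integral M (e : 'I_(nelt M) * 'I_3 * 'I_(nelt M))
    (f : R * R -> R) : R :=
  let a := vtx e.1.1 (ordS e.1.2) in
  let b := vtx e.1.1 (ord_pred e.1.2) in
  edist a b *
  \int[@lebesgue_measure R]_(t in `[0, 1]) f ((1 - t) *: a + t *: b).

(* Value at [x] of [p] restricted to [T]: the limit from inside [T]. *)
Definition trace M (T : 'I_(nelt M)) (p : R * R -> R) (x : R * R) : R :=
  lim ((p : R * R -> R^o) @ within ((elem T)°) (nbhs x)).

Definition jump M (e : 'I_(nelt M) * 'I_3 * 'I_(nelt M))
    (p : R * R -> R) (x : R * R) : R :=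
  trace e.1.1 p x - trace e.2 p x.

(* ([[D^j p]], [[D^j q]])_F, summed over the multi-indices (a, j - a). *)
Definition jump_product M (e : 'I_(nelt M) * 'I_3 * 'I_(nelt M)) (j : nat)
    (p q : R * R -> R) : R :=
  \sum_(a < j.+1) edge_integral e (fun x =>
    jump e (iter a dx (iter (j - a) dy p)) x *
    jump e (iter a dx (iter (j - a) dy q)) x).

(* Divergence taken elementwise on the active elements, and set to 0 on the
   mesh skeleton, which is a null set. *)
Definition mesh_div M Om (v : R * R -> R * R) : R * R -> R :=
  classical_div v \_ (active_interiors M Om).

Inductive fe_family := RT | BDM.

Definition admissible_order (fam : fe_family) (k : nat) : Prop :=
  match fam with RT => True | BDM => (1 <= k)%N end.

Definition khat (fam : fe_family) (k : nat) : nat :=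
  match fam with RT => k | BDM => k.-1 end.

Definition local_V (fam : fe_family) (k : nat) (A : set (R * R))
    (v : R * R -> R * R) : Prop :=
  match fam with
  | RT => exists (p1 p2 q : R * R -> R),
      [/\ poly_on k A p1, poly_on k A p2, poly_on k A q &
          forall x, A x -> v x = (p1 x, p2 x) + q x *: x]
  | BDM => poly_on k A (fun x => (v x).1) /\ poly_on k A (fun x => (v x).2)
  end.

(* Discontinuous functions are prescribed on the interiors of the elements:
   neighbouring closed elements overlap along their common edge. *)
Definition Vh M Om (fam : fe_family) (k : nat) (v : R * R -> R * R) : Prop :=
  Hdiv ((active_domain M Om)°) v /\
  forall T : 'I_(nelt M), active Om T -> local_V fam k ((elem T)°) v.

Definition Qh M Om (m : nat) (q : R * R -> R) : Prop :=
  forall T : 'I_(nelt M), active Om T -> poly_on m ((elem T)°) q.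

Definition B0 M Om (m : nat) (tau_b : R) (hF : set (R * R) -> R)
    (v : R * R -> R * R) (q : R * R -> R) : R :=
  \int[area]_(x in Om)
     (mesh_div M Om v x * q x) +
  \sum_(e : 'I_(nelt M) * 'I_3 * 'I_(nelt M) | `[< stab_edge Om e >])
    \sum_(j < m.+1)
      tau_b * hF (edge_set e) ^+ (2 * j + 1) *
      jump_product e j (mesh_div M Om v) q.

End Meshes.

(* Main.v *)
Require Import Defs.
From mathcomp Require Import all_boot all_order all_algebra.
From mathcomp Require Import all_classical all_reals all_analysis.
From mathcomp Require Import measurable_realfun ring lra.
Import Order.TTheory GRing.Theory Num.Theory.
Import numFieldNormedType.Exports.
Local Open Scope classical_set_scope.
Local Open Scope ring_scope.

(** Let p be the elementwise divergence of u on the active mesh, extended by 0.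
    On each active element it is a polynomial of degree at most khat
    ([local_V_extend]), so p is itself an admissible test function.  Testing
    with q = p turns the hypothesis into

      int_Om p^2 + (sum of weighted squared jumps) = 0.

    The stabilisation terms are nonnegative ([jump_terms_ge0]), so the integral
    of p^2 over Om vanishes.  The interior of an active element T meets the open
    set Om, since T does and the interior of a triangle accumulates at each of
    its points ([open_elem_meets]).  Thus the polynomial that represents p on T
    vanishes on a nonempty open set, hence identically
    ([piecewise_poly_eq0], [poly_on_eq0]).

    It remains to pass from elements to the distributional divergence.  As u is
    in H(div), its distributional divergence is a function g in L^2, and the
    identity to prove is int_D g phi = 0 for each test function phi on the
    active domain D.  Multiply phi by smooth cutoffs chi_n supported inside one
    triangle T and tending to 1 there.  Since phi chi_n is a test function
    supported in T, where u agrees with a smooth field (v1, v2) of zero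
    divergence,

      int g phi chi_n = - int u . grad (phi chi_n)
                      = - int div (phi chi_n (v1, v2)) = 0

    by Fubini and the fundamental theorem of calculus
    ([integral_dot_grad_csupp]).  Dominated convergence gives
    int_T g phi = 0 ([integral_open_elem0]); the open triangles are pairwise
    disjoint by conformity and fill D up to finitely many line segments, which
    are null sets, so summing over T concludes ([weak_div_eq0]). *)

(** * Functions p(1/t) exp(-1/t), flat at 0 *)

Section Flat.
Context {R : realType}.
Implicit Types (p : {poly R}) (s t a b c : R).

(** The usual smooth step exp(-1/t) is the case [p = 1]; the factor [p.[t^-1]]
    makes the family stable under differentiation, so that smoothness follows
    by induction from a single derivative computation. *)
Definition flat p t : R := if 0 < t then p.[t^-1] * expR (- t^-1) else 0.

(** By s^(i+2) / (i+2)! <= exp s at s = 1/t, each monomial of [p] contributes at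
    most a multiple of t^2.  The order 2 is what makes the derivative at 0
    exist and vanish. *)
Lemma flat_bound p : exists C, forall t, `|flat p t| <= C * t ^+ 2.
Proof.
exists (\sum_(i < size p) `|p`_i| * (i.+2)`!%:R) => t.
have C0 : 0 <= \sum_(i < size p) `|p`_i| * (i.+2)`!%:R.
  by apply: sumr_ge0 => i _; rewrite mulr_ge0.
rewrite /flat; case: ifPn => [t0|_]; last by rewrite normr0 mulr_ge0 ?sqr_ge0.
rewrite normrM (ger0_norm (expR_ge0 _)) horner_coef.
apply: (le_trans (ler_wpM2r (expR_ge0 _) (ler_norm_sum _ _ _))).
rewrite mulr_suml mulr_suml; apply: ler_sum => i _.
rewrite normrM normrX -!mulrA ler_wpM2l// gtr0_norm ?invr_gt0//.
have := @expR_ge1Dxn R t^-1 i.+1 (ltW _); rewrite invr_gt0 t0 => /(_ isT) H.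
rewrite expRN ler_pdivrMr ?expR_gt0//.
apply: (@le_trans _ _ ((i.+2)`!%:R * t ^+ 2 * (t^-1 ^+ i.+2 / (i.+2)`!%:R))).
  rewrite mulrC mulrA divfK ?pnatr_eq0 -?lt0n ?fact_gt0//.
  rewrite -addn2 exprD -mulrA -exprMn.
  by rewrite mulVf ?gt_eqF// expr1n mulr1.
rewrite ler_wpM2l ?mulr_ge0 ?ler0n ?(ltW t0)//.
by apply: le_trans H; rewrite lerDr.
Qed.

Lemma is_derive_flat p t :
  is_derive t 1 (flat p) (flat ('X^2 * (p - p^`())) t).
Proof.
have [t0|t0|t0] := ltgtP t 0.
- rewrite /flat; case: ifPn => [t1|_]; first by have := lt_trans t0 t1; rewrite ltxx.
  apply: (@near_eq_is_derive _ _ _ (cst 0)).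
  near=> y; rewrite /=; case: ifPn => // y0.
  have : y < 0 by near: y; exact: lt_nbhsl.
  by move=> /(lt_trans y0); rewrite ltxx.
- apply: (@near_eq_is_derive _ _ _ (fun t => p.[t^-1] * expR (- t^-1))).
    by near=> y; rewrite /flat ifT//; near: y; exact: lt_nbhsr.
  have dV : is_derive t 1 (fun t : R => t^-1) (- t^-1 ^+ 2).
    have := @is_deriveV _ id t 1 1; rewrite gt_eqF// => /(_ isT (is_derive_id _ _)).
    by move/is_derive_eq; apply; rewrite /= scaler1 exprVn.
  have dp : is_derive t 1 (fun t : R => p.[t^-1]) (p^`().[t^-1] * - t^-1 ^+ 2).
    exact: (@is_derive1_comp _ (horner p) (fun t => t^-1)).
  have de : is_derive t 1 (fun t : R => expR (- t^-1)) (expR (- t^-1) * t^-1 ^+ 2).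
    have dN : is_derive t 1 (fun t : R => - t^-1) (t^-1 ^+ 2).
      by have := is_deriveN dV; move/is_derive_eq; apply; rewrite opprK.
    exact: (@is_derive1_comp _ expR (fun t => - t^-1)).
  have := is_deriveM dp de; move/is_derive_eq; apply.
  rewrite /flat t0 hornerM hornerD hornerN hornerXn /GRing.scale /=.
  by move: (t^-1) (expR _) (p^`().[_]) (p.[_]) => s e Q P; ring.
- rewrite t0.
  have f0 q : flat q 0 = 0 by rewrite /flat ltxx.
  have [C HC] := flat_bound p.
  rewrite f0.
  suff H : (fun h : R => h^-1 *: ((flat p \o shift 0) (h *: 1) - flat p 0)) @ 0^' --> (0:R).
    by apply: DeriveDef; [apply/cvg_ex; exists 0|apply/cvg_lim].
  have C0 : 0 <= C by have := HC 1; rewrite expr1n mulr1; exact: le_trans.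
  apply/cvgr0Pnorm_lt => e e0; near=> h.
  rewrite f0 subr0 /= addr0 scaler1.
  have h0 : h != 0 by near: h; exact: nbhs_dnbhs_neq.
  rewrite normrM normfV mulrC ltr_pdivrMr ?normr_gt0//.
  apply: (le_lt_trans (HC h)); rewrite -[h ^+ 2]ger0_norm ?sqr_ge0// normrX expr2 mulrA.
  rewrite ltr_pM2r ?normr_gt0//.
  have hC : `|h| < e / (C + 1).
    near: h; apply: dnbhs0_lt; rewrite divr_gt0// ltr_wpDl//.
  rewrite ltr_pdivlMr ?ltr_wpDl// in hC.
  apply: le_lt_trans hC; rewrite mulrC ler_wpM2l// lerDl//.
Unshelve. all: by end_near. Qed.

End Flat.

(** * Functions of class C^n on the plane *)

Section Smooth.
Context {R : realType}.
Implicit Types (f g : R * R -> R) (x v : R * R) (a b c : R).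

(** A directional derivative only sees the restriction to a line, so it can be
    computed by one-variable calculus, and conversely. *)
Lemma slice_is_derive (f : R * R -> R) (g : R -> R) x v (t d : R) :
  (forall h, g (h + t) = f (h *: v + x)) ->
  is_derive t 1 g d <-> is_derive x v (f : R * R -> R^o) d.
Proof.
move=> fg.
have E : (fun h : R => h^-1 *: ((g \o shift t) (h *: 1) - g t)) =
         (fun h : R => h^-1 *: (((f : R * R -> R^o) \o shift x) (h *: v) - f x)).
  apply/funext => h /=; congr (_ *: (_ - _)).
    by rewrite -fg /GRing.scale/= mulr1.
  by have := fg 0; rewrite add0r scale0r add0r.
split=> -[d1 d2]; apply: DeriveDef; move: d1 d2; rewrite /derivable /derive E //.
Qed.

Lemma slice_dx f y (t d : R) :
  is_derive t 1 (fun s => f (s, y)) d <->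
  is_derive (t, y) ((1, 0) : R * R) (f : R * R -> R^o) d.
Proof.
apply: slice_is_derive => h; congr f.
by rewrite /GRing.scale/= /GRing.add /= /add_pair /= /scale_pair /= /GRing.scale /=
  mulr1 mulr0 add0r.
Qed.

Lemma slice_dy f y (t d : R) :
  is_derive t 1 (fun s => f (y, s)) d <->
  is_derive (y, t) ((0, 1) : R * R) (f : R * R -> R^o) d.
Proof.
apply: slice_is_derive => h; congr f.
by rewrite /GRing.scale/= /GRing.add /= /add_pair /= /scale_pair /= /GRing.scale /=
  mulr1 mulr0 add0r.
Qed.

Lemma CnW n f : Cn n.+1 f -> Cn n f.
Proof.
elim: n f => [|n IH] f; first by case.
move=> [cf [dfx dfy Cx Cy]]; exact: (conj cf (And4 dfx dfy (IH _ Cx) (IH _ Cy))).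
Qed.

Lemma Cn_continuous n f : Cn n f -> continuous f.
Proof. by case: n => [|n] []. Qed.

Lemma Cn_dx n f : Cn n.+1 f -> Cn n (dx f).
Proof. by case=> _ []. Qed.

Lemma Cn_dy n f : Cn n.+1 f -> Cn n (dy f).
Proof. by case=> _ []. Qed.

Lemma Cn_is_dx n f x : Cn n.+1 f ->
  is_derive x ((1, 0) : R * R) (f : R * R -> R^o) (dx f x).
Proof. by case=> _ [H _ _ _]; apply: DeriveDef => //; exact: H. Qed.

Lemma Cn_is_dy n f x : Cn n.+1 f ->
  is_derive x ((0, 1) : R * R) (f : R * R -> R^o) (dy f x).
Proof. by case=> _ [_ H _ _]; apply: DeriveDef => //; exact: H. Qed.

(** The successor clause of [Cn] is about the operators [dx] and [dy]; this
    form accepts any explicit candidates for the partial derivatives. *)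
Lemma CnS n f fx fy : continuous f ->
  (forall x, is_derive x ((1, 0) : R * R) (f : R * R -> R^o) (fx x)) ->
  (forall x, is_derive x ((0, 1) : R * R) (f : R * R -> R^o) (fy x)) ->
  Cn n fx -> Cn n fy -> Cn n.+1 f.
Proof.
move=> cf dfx dfy Cx Cy; split=> //.
have -> : dx f = fx by apply/funext => x; case: (dfx x).
have -> : dy f = fy by apply/funext => x; case: (dfy x).
by split.
Qed.

Lemma Cn_cst n c : Cn n (fun=> c).
Proof.
elim: n c => [|n IH] c; first by split=> //; exact: cst_continuous.
apply: (CnS n _ (fun=> 0) (fun=> 0)) => //.
  exact: cst_continuous.
Qed.

Lemma is_derive_funD f g x (d e : R) v : is_derive x v (f : R * R -> R^o) d ->
  is_derive x v (g : R * R -> R^o) e ->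
  is_derive x v ((fun x => f x + g x) : R * R -> R^o) (d + e).
Proof. by move=> ? ?; exact: is_deriveD. Qed.

Lemma is_derive_funM f g x (d e : R) v : is_derive x v (f : R * R -> R^o) d ->
  is_derive x v (g : R * R -> R^o) e ->
  is_derive x v ((fun x => f x * g x) : R * R -> R^o) (d * g x + f x * e).
Proof.
move=> df dg; have := is_deriveM df dg; move/is_derive_eq; apply.
by rewrite addrC /GRing.scale /= [g x * d]mulrC.
Qed.

Lemma CnD n f g : Cn n f -> Cn n g -> Cn n (fun x => f x + g x).
Proof.
elim: n f g => [|n IH] f g Cf Cg.
  split=> // x; apply: continuousD.
    exact: Cn_continuous Cf x.
  exact: Cn_continuous Cg x.
apply: (CnS n _ (fun x => dx f x + dx g x) (fun x => dy f x + dy g x)).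
- by move=> x; apply: continuousD; [exact: Cn_continuous Cf x|exact: Cn_continuous Cg x].
- move=> x; apply: is_derive_funD; first exact: (Cn_is_dx n _ _ Cf).
  exact: (Cn_is_dx n _ _ Cg).
- move=> x; apply: is_derive_funD; first exact: (Cn_is_dy n _ _ Cf).
  exact: (Cn_is_dy n _ _ Cg).
- by apply: IH; exact: Cn_dx.
- by apply: IH; exact: Cn_dy.
Qed.

Lemma CnM n f g : Cn n f -> Cn n g -> Cn n (fun x => f x * g x).
Proof.
elim: n f g => [|n IH] f g Cf Cg.
  split=> // x; apply: continuousM.
    exact: Cn_continuous Cf x.
  exact: Cn_continuous Cg x.
apply: (CnS n _ (fun x => dx f x * g x + f x * dx g x)
  (fun x => dy f x * g x + f x * dy g x)).
- by move=> x; apply: continuousM; [exact: Cn_continuous Cf x|exact: Cn_continuous Cg x].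
- move=> x; apply: is_derive_funM; first exact: (Cn_is_dx n _ _ Cf).
  exact: (Cn_is_dx n _ _ Cg).
- move=> x; apply: is_derive_funM; first exact: (Cn_is_dy n _ _ Cf).
  exact: (Cn_is_dy n _ _ Cg).
- by apply: CnD; apply: IH; first [exact: Cn_dx | exact: CnW].
- by apply: CnD; apply: IH; first [exact: Cn_dy | exact: CnW].
Qed.

Definition affine a b c x : R := a * x.1 + b * x.2 + c.

Lemma continuous_affine a b c : continuous (affine a b c).
Proof.
move=> x; apply: cvgD; last exact: cvg_cst.
apply: cvgD; apply: cvgM; first [exact: cvg_cst|exact: cvg_fst|exact: cvg_snd].
Qed.

Lemma is_derive_comp_affine (F : R -> R) a b c x (d : R) v :
  is_derive (affine a b c x) 1 F d ->
  is_derive x v (fun x => F (affine a b c x) : R^o) (d * (a * v.1 + b * v.2)).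
Proof.
move=> dF.
set k := a * v.1 + b * v.2.
apply/(@slice_is_derive _ (fun h => F (affine a b c x + k * h)) _ _ 0).
  move=> h; rewrite addr0 /affine /k; congr F.
  by case: x v {dF k} => x1 x2 [v1 v2]; rewrite /= /GRing.scale /=; ring.
apply: (@is_derive1_comp _ F (fun h => affine a b c x + k * h)).
  by rewrite mulr0 addr0.
have H : is_derive (0:R) 1
    ((fun h : R => affine a b c x) + (fun h : R => k *: (h : R^o)))
    (0 + k *: (1 : R^o)).
  exact: is_deriveD.
by move: H; rewrite add0r /GRing.scale /= mulr1.
Qed.

Lemma Cn_affine n a b c : Cn n (affine a b c).
Proof.
case: n => [|n]; first by split=> //; exact: continuous_affine.
apply: (CnS n _ (fun=> a) (fun=> b)); try exact: Cn_cst.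
- exact: continuous_affine.
- move=> x; have := @is_derive_comp_affine id a b c x 1 (1, 0) _.
  by rewrite mul1r /= mulr1 mulr0 addr0; apply.
- move=> x; have := @is_derive_comp_affine id a b c x 1 (0, 1) _.
  by rewrite mul1r /= mulr1 mulr0 add0r; apply.
Qed.

Lemma Cn_flat n p a b c : Cn n (fun x => flat p (affine a b c x)).
Proof.
have cf q : continuous (fun x => flat q (affine a b c x)).
  move=> x; apply: continuous_comp; first exact: continuous_affine.
  apply/differentiable_continuous/derivable1_diffP.
  by case: (is_derive_flat q (affine a b c x)).
elim: n p => [|n IH] p; first by split.
apply: (CnS n _ (fun x => flat ('X^2 * (p - p^`())) (affine a b c x) * a)
  (fun x => flat ('X^2 * (p - p^`())) (affine a b c x) * b)) => //.
- move=> x; have := @is_derive_comp_affine (flat p) a b c x _ (1, 0) (is_derive_flat _ _).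
  by rewrite /= mulr1 mulr0 addr0.
- move=> x; have := @is_derive_comp_affine (flat p) a b c x _ (0, 1) (is_derive_flat _ _).
  by rewrite /= mulr1 mulr0 add0r.
- by apply: CnM; [exact: IH|exact: Cn_cst].
- by apply: CnM; [exact: IH|exact: Cn_cst].
Qed.

End Smooth.

(** * Polynomial functions of two variables *)

Section Polynomials.
Context {R : realType}.
Implicit Types (f g : R * R -> R) (x v : R * R) (c : R).

(** The local data are polynomial only on an element; calculus and the
    integration by parts use the extension to the whole plane. *)
Lemma poly_on_extend m A f : poly_on m A f ->
  exists2 g, poly_on m setT g & forall x, A x -> f x = g x.
Proof.
by case=> c fE; exists (fun x => \sum_(i < m.+1) \sum_(j < m.+1 | (i + j <= m)%N)
            c i j * x.1 ^+ i * x.2 ^+ j) => //; exists c.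
Qed.

Lemma poly_on_eq m A f g : (forall x, A x -> f x = g x) ->
  poly_on m A g -> poly_on m A f.
Proof. by move=> fg [c gE]; exists c => x Ax; rewrite fg// gE. Qed.

Lemma poly_on_sub m A B f : A `<=` B -> poly_on m B f -> poly_on m A f.
Proof. by move=> AB [c fE]; exists c => x /AB; exact: fE. Qed.

Lemma poly_onD m A f g : poly_on m A f -> poly_on m A g ->
  poly_on m A (fun x => f x + g x).
Proof.
move=> [c fE] [d gE]; exists (fun i j => c i j + d i j) => x Ax.
rewrite fE// gE// -big_split; apply: eq_bigr => i _.
by rewrite -big_split; apply: eq_bigr => j _; rewrite !mulrDl.
Qed.

Lemma poly_on_monomial m A c i j : (i + j <= m)%N ->
  poly_on m A (fun x => c * x.1 ^+ i * x.2 ^+ j).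
Proof.
move=> ijm; exists (fun k l => if (k == i) && (l == j) then c else 0) => x _.
have im : (i < m.+1)%N by rewrite ltnS (leq_trans _ ijm)// leq_addr.
have jm : (j < m.+1)%N by rewrite ltnS (leq_trans _ ijm)// leq_addl.
rewrite (bigD1 (Ordinal im))//= (bigD1 (Ordinal jm))//= !eqxx/=.
rewrite [X in _ + X + _]big1; last first.
  move=> l /andP[_ lj]; rewrite ifF ?mul0r//.
  by apply/negP => /eqP jE; case/eqP: lj; exact: val_inj.
rewrite [X in _ + X]big1 ?addr0// => k ki; rewrite big1// => l _.
rewrite ifF ?mul0r//; apply/negP => /andP[/eqP kE _]; case/eqP: ki; exact: val_inj.
Qed.

Lemma poly_on0 m A : poly_on m A (fun=> 0 : R).
Proof.
by apply: (poly_on_eq _ _ _ _ _ (poly_on_monomial m A 0 0 0 (leq0n _))) => x _; rewrite !mul0r.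
Qed.

(** Properties of polynomial functions are proved on monomials and propagated
    through sums, without manipulating coefficients. *)
Lemma poly_on_ind m (P : (R * R -> R) -> Prop) :
  P (fun=> 0) -> (forall f g, P f -> P g -> P (fun x => f x + g x)) ->
  (forall c i j, (i + j <= m)%N -> P (fun x => c * x.1 ^+ i * x.2 ^+ j)) ->
  forall f, poly_on m setT f -> P f.
Proof.
move=> P0 PD Pm f [c fE].
have PS (I : Type) (r : seq I) (Q : pred I) (F : I -> R * R -> R) :
    (forall i, Q i -> P (F i)) -> P (fun x => \sum_(i <- r | Q i) F i x).
  move=> PF; elim: r => [|i r IH]; first by under eq_fun do rewrite big_nil.
  have [Qi|nQi] := boolP (Q i).
    by under eq_fun do rewrite big_cons Qi; apply: PD => //; exact: PF.
  by under eq_fun do rewrite big_cons (negPf nQi).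
have -> : f = (fun x => \sum_(i < m.+1) \sum_(j < m.+1 | (i + j <= m)%N)
            c i j * x.1 ^+ i * x.2 ^+ j) by apply/funext => x; exact: fE.
by apply: (PS) => i _; apply: PS => j ij; exact: Pm.
Qed.

Lemma poly_onW m m' A f : (m <= m')%N -> poly_on m A f -> poly_on m' A f.
Proof.
move=> mm' /poly_on_extend[g pg fg]; apply: (poly_on_eq _ _ _ _ fg).
apply: (poly_on_sub _ _ setT) => //; move: g pg {fg}; apply: poly_on_ind.
- exact: poly_on0.
- by move=> f1 f2; exact: poly_onD.
- by move=> c i j ij; apply: poly_on_monomial; exact: leq_trans ij _.
Qed.

Lemma Cn_fst n : Cn n (fun x : R * R => x.1).
Proof.
have -> : (fun x : R * R => x.1) = affine 1 0 0.
  by apply/funext => x; rewrite /affine mul1r mul0r !addr0.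
exact: Cn_affine.
Qed.

Lemma Cn_snd n : Cn n (fun x : R * R => x.2).
Proof.
have -> : (fun x : R * R => x.2) = affine 0 1 0.
  by apply/funext => x; rewrite /affine mul1r mul0r addr0 add0r.
exact: Cn_affine.
Qed.

Lemma Cn_exp n f i : Cn n f -> Cn n (fun x => f x ^+ i).
Proof.
move=> Cf; elim: i => [|i IH].
  by under eq_fun do rewrite expr0; exact: Cn_cst.
by under eq_fun do rewrite exprS; exact: CnM.
Qed.

Lemma poly_on_Cn n m f : poly_on m setT f -> Cn n f.
Proof.
move: f; apply: poly_on_ind; first exact: Cn_cst.
- by move=> f g; exact: CnD.
- move=> c i j _; apply: CnM; last by apply: Cn_exp; exact: Cn_snd.
  by apply: CnM; [exact: Cn_cst|apply: Cn_exp; exact: Cn_fst].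
Qed.

Lemma dx_monomial c i j :
  dx (fun x : R * R => c * x.1 ^+ i * x.2 ^+ j) =
  (fun x => (c * i%:R) * x.1 ^+ i.-1 * x.2 ^+ j).
Proof.
apply/funext => -[s t].
have H := @is_derive_poly R ((c * t ^+ j) *: 'X^i) s.
have E : horner ((c * t ^+ j) *: 'X^i) = (fun s => c * s ^+ i * t ^+ j).
  by apply/funext => r; rewrite hornerZ hornerXn mulrAC.
rewrite E derivZ derivXn hornerZ hornerMn hornerXn in H.
have [_ d] := (slice_dx (fun x => c * x.1 ^+ i * x.2 ^+ j) t s _).1 H.
by rewrite /dx d /= -mulr_natr; ring.
Qed.

Lemma dy_monomial c i j :
  dy (fun x : R * R => c * x.1 ^+ i * x.2 ^+ j) =
  (fun x => (c * j%:R) * x.1 ^+ i * x.2 ^+ j.-1).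
Proof.
apply/funext => -[s t].
have H := @is_derive_poly R ((c * s ^+ i) *: 'X^j) t.
have E : horner ((c * s ^+ i) *: 'X^j) = (fun t => c * s ^+ i * t ^+ j).
  by apply/funext => r; rewrite hornerZ hornerXn.
rewrite E derivZ derivXn hornerZ hornerMn hornerXn in H.
have [_ d] := (slice_dy (fun x => c * x.1 ^+ i * x.2 ^+ j) s t _).1 H.
by rewrite /dy d /= -mulr_natr; ring.
Qed.

Lemma dxD f g : Cn 1 f -> Cn 1 g ->
  dx (fun x => f x + g x) = (fun x => dx f x + dx g x).
Proof.
move=> Cf Cg; apply/funext => x.
by case: (is_derive_funD f g x _ _ _ (Cn_is_dx 0 f x Cf) (Cn_is_dx 0 g x Cg)).
Qed.

Lemma dyD f g : Cn 1 f -> Cn 1 g ->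
  dy (fun x => f x + g x) = (fun x => dy f x + dy g x).
Proof.
move=> Cf Cg; apply/funext => x.
by case: (is_derive_funD f g x _ _ _ (Cn_is_dy 0 f x Cf) (Cn_is_dy 0 g x Cg)).
Qed.

Lemma dx_cst c : dx (fun=> c) = (fun=> 0).
Proof. by apply/funext => x; rewrite /dx derive_cst. Qed.

Lemma dy_cst c : dy (fun=> c) = (fun=> 0).
Proof. by apply/funext => x; rewrite /dy derive_cst. Qed.

Lemma poly_on_dx m f : poly_on m setT f -> poly_on m.-1 setT (dx f).
Proof.
move=> pf; suff [] : Cn 1 f /\ poly_on m.-1 setT (dx f) by [].
move: f pf; apply: poly_on_ind.
- by rewrite dx_cst; split; [exact: Cn_cst|exact: poly_on0].
- move=> f g [Cf pf] [Cg pg]; split; first exact: CnD.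
  by rewrite dxD//; exact: poly_onD.
- move=> c i j ij; split.
    by apply: (poly_on_Cn _ m); exact: poly_on_monomial.
  rewrite dx_monomial; case: i ij => [|i] ij.
    by under eq_fun do rewrite mulr0 !mul0r; exact: poly_on0.
  by apply: poly_on_monomial; rewrite -ltnS (leq_trans ij)// leqSpred.
Qed.

Lemma poly_on_dy m f : poly_on m setT f -> poly_on m.-1 setT (dy f).
Proof.
move=> pf; suff [] : Cn 1 f /\ poly_on m.-1 setT (dy f) by [].
move: f pf; apply: poly_on_ind.
- by rewrite dy_cst; split; [exact: Cn_cst|exact: poly_on0].
- move=> f g [Cf pf] [Cg pg]; split; first exact: CnD.
  by rewrite dyD//; exact: poly_onD.
- move=> c i j ij; split.
    by apply: (poly_on_Cn _ m); exact: poly_on_monomial.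
  rewrite dy_monomial; case: j ij => [|j] ij.
    by under eq_fun do rewrite mulr0 !mul0r; exact: poly_on0.
  by apply: poly_on_monomial; rewrite /= -ltnS -addnS (leq_trans ij)// leqSpred.
Qed.

(** Multiplying by the coordinate raises the degree and differentiating in the
    same coordinate lowers it: c x^i y^j becomes c (i+1) x^i y^j.  This is why
    the divergence of x Q_k stays of degree k. *)
Lemma poly_on_dx_mulx m f : poly_on m setT f ->
  poly_on m setT (dx (fun x => f x * x.1)).
Proof.
move=> pf; suff [] : Cn 1 f /\ poly_on m setT (dx (fun x => f x * x.1)) by [].
move: f pf; apply: poly_on_ind.
- split; first exact: Cn_cst.
  by under eq_fun do rewrite mul0r; rewrite dx_cst; exact: poly_on0.
- move=> f g [Cf pf] [Cg pg]; split; first exact: CnD.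
  under eq_fun do rewrite mulrDl.
  by rewrite dxD; [exact: poly_onD|apply: CnM => //; exact: Cn_fst..].
- move=> c i j ij; split.
    by apply: (poly_on_Cn _ m); exact: poly_on_monomial.
  under eq_fun do rewrite mulrAC -[_ * _ * _.1]mulrA -exprSr.
  by rewrite dx_monomial; exact: poly_on_monomial.
Qed.

Lemma poly_on_dy_muly m f : poly_on m setT f ->
  poly_on m setT (dy (fun x => f x * x.2)).
Proof.
move=> pf; suff [] : Cn 1 f /\ poly_on m setT (dy (fun x => f x * x.2)) by [].
move: f pf; apply: poly_on_ind.
- split; first exact: Cn_cst.
  by under eq_fun do rewrite mul0r; rewrite dy_cst; exact: poly_on0.
- move=> f g [Cf pf] [Cg pg]; split; first exact: CnD.
  under eq_fun do rewrite mulrDl.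
  by rewrite dyD; [exact: poly_onD|apply: CnM => //; exact: Cn_snd..].
- move=> c i j ij; split.
    by apply: (poly_on_Cn _ m); exact: poly_on_monomial.
  under eq_fun do rewrite -mulrA -exprSr.
  by rewrite dy_monomial; exact: poly_on_monomial.
Qed.

Lemma poly_on_line m f z d : poly_on m setT f ->
  exists q : {poly R}, forall t, q.[t] = f (z + t *: d).
Proof.
move: f; apply: poly_on_ind.
- by exists 0 => t; rewrite horner0.
- by move=> f g [p pE] [q qE]; exists (p + q) => t; rewrite hornerD pE qE.
- move=> c i j _; exists (c *: ((z.1%:P + d.1 *: 'X) ^+ i * (z.2%:P + d.2 *: 'X) ^+ j)) => t.
  have -> : (z + t *: d).1 = z.1 + d.1 * t by rewrite mulrC.
  have -> : (z + t *: d).2 = z.2 + d.2 * t by rewrite mulrC.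
  by rewrite !hornerE.
Qed.

Lemma poly_eq0_near0 (q : {poly R}) : (\forall t \near (0:R), q.[t] = 0) -> q = 0.
Proof.
move=> /nbhs_ballP[e /= e0 He]; apply/eqP/negPn/negP => q0.
(* More distinct roots than the degree allows, all within distance e of 0. *)
pose rs := [seq e / k.+2%:R | k <- iota 0 (size q)].
have rsq : all (root q) rs.
  apply/allP => _ /mapP[k _ ->]; apply/eqP/He.
  rewrite /ball/= sub0r normrN ger0_norm ?divr_ge0 ?ltW//.
  by rewrite ltr_pdivrMr ?ltr0n// ltr_pMr// ltr1n.
have urs : uniq rs.
  rewrite map_inj_uniq ?iota_uniq// => k l /(mulfI (lt0r_neq0 e0))/invr_inj/eqP.
  by rewrite eqr_nat => /eqP[].
by have := max_poly_roots q0 rsq urs; rewrite size_map size_iota ltnn.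
Qed.

(** On the segment from a point [z] of [U] to any [x], the function is a
    polynomial in one variable that vanishes near the parameter of [z], hence
    also at the parameter of [x]. *)
Lemma poly_on_eq0 m f (U : set (R * R)) : poly_on m setT f ->
  open U -> U !=set0 -> (forall x, U x -> f x = 0) -> forall x, f x = 0.
Proof.
move=> pf oU [z Uz] fU x.
have [q qE] := poly_on_line _ _ z (x - z) pf.
suff q0 : q = 0.
  by rewrite -[x](subrKC z) -[x - z]scale1r -qE q0 horner0.
apply: poly_eq0_near0.
have : (fun t : R => z + t *: (x - z)) t @[t --> (0:R)] --> z + 0 *: (x - z).
  by apply: cvgD; [exact: cvg_cst|apply: cvgZr_tmp; exact: cvg_id].
rewrite scale0r addr0.
move=> /(_ U) /(_ (open_nbhs_nbhs (conj oU Uz))) nU.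
have {}nU : \forall t \near (0:R), U (z + t *: (x - z)) by [].
by apply: filterS nU => t Ut; rewrite qE fU.
Qed.

End Polynomials.

(** * Borel sets and integrals on the plane *)

(** [R * R] carries two sigma-algebra structures that are convertible but have
    different displays; [plane] is the one over which the product measure
    [area] is defined. *)
Section PlaneMeasure.
Context {R : realType}.
Implicit Types (f : R * R -> R) (x : R * R) (U A D : set (R * R)) (M : R).

Local Notation area := (@lebesgue_measure R \x @lebesgue_measure R)%E.
Local Notation plane := (measurableTypeR R * measurableTypeR R)%type.

(** An open set is the union of the open boxes with rational corners that it
    contains, and there are countably many of those. *)
Lemma open_measurable2 U : open U -> measurable (U : set plane).
Proof.
move=> oU; suff : measurable U by [].
pose B (q : (rat * rat) * (rat * rat)) : set (R * R) :=
  `]ratr q.1.1, ratr q.1.2[%classic `*` `]ratr q.2.1, ratr q.2.2[%classic.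
have -> : U = \bigcup_q (if `[< B q `<=` U >] then B q else set0).
  apply/seteqP; split=> [x Ux|x [q _]]; last by case: asboolP => // qU /qU.
  have /nbhs_ballP[e /= e0 eU] := open_nbhs_nbhs (conj oU Ux).
  have hl (a : R) : a - e < a by rewrite ltrBlDr ltrDl.
  have hr (a : R) : a < a + e by rewrite ltrDl.
  have [a ha] := rat_in_itvoo (hl x.1); have [b hb] := rat_in_itvoo (hr x.1).
  have [c hc] := rat_in_itvoo (hl x.2); have [d hd] := rat_in_itvoo (hr x.2).
  move: ha hb hc hd; rewrite !in_itv/= => /andP[a1 a2] /andP[b1 b2] /andP[c1 c2] /andP[d1 d2].
  exists ((a, b), (c, d)) => //.
  have Bx : B ((a, b), (c, d)) x by split; rewrite /= in_itv/= ?a2 ?c2.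
  case: asboolP => // nB; exfalso; apply: nB => y [/= + +].
  rewrite !in_itv/= => /andP[y1 y2] /andP[y3 y4].
  by apply: eU; split; rewrite /ball/= ltr_distlC; apply/andP; split; lra.
apply: countable_bigcupT_measurable => // q; case: ifPn => // _.
by apply: measurableX; exact: measurable_itv.
Qed.

Lemma closed_measurable2 A : closed A -> measurable (A : set plane).
Proof. by move=> /closed_openC/open_measurable2/measurableC; rewrite setCK. Qed.

Lemma continuous_measurable2 f D : measurable (D : set plane) ->
  continuous f -> measurable_fun (D : set plane) (f : plane -> R).
Proof.
move=> mD cf; apply: (measurable_funS measurableT) => //.
apply: (measurability _ (RGenOpens.measurableE R)).
move=> _ [_ [a [b ->] <-]]; rewrite setTI; apply: open_measurable2.
by move/continuousP : cf; apply; exact: interval_open.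
Qed.

Definition box M : set (R * R) := `[- M, M]%classic `*` `[- M, M]%classic.

Lemma boxE M x : box M x <-> `|x.1| <= M /\ `|x.2| <= M.
Proof. by rewrite /box /= !in_itv/= !ler_norml. Qed.

Lemma compact_box M : compact (box M).
Proof. by apply: compact_setX; exact: segment_compact. Qed.

Lemma closed_box M : closed (box M).
Proof. by apply: compact_closed; [exact: norm_hausdorff|exact: compact_box]. Qed.

Lemma measurable_box M : measurable (box M : set plane).
Proof. by apply: measurableX; exact: measurable_itv. Qed.

Lemma area_box_fin M : (area (box M) < +oo)%E.
Proof.
rewrite product_measure1E; try exact: measurable_itv.
rewrite /= !lebesgue_measure_itv/=; case: ifPn => _; last by rewrite mule0.
by rewrite -EFinB -EFinM ltry.
Qed.

Lemma bounded_box A : bounded_set A -> exists2 M, 0 <= M & A `<=` box M.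
Proof.
move=> [M [_ HM]]; exists (`|M| + 1); first by rewrite addr_ge0.
move=> x Ax; have := HM (`|M| + 1) _ x Ax.
have : M < `|M| + 1 by rewrite (le_lt_trans (ler_norm _))// ltrDl.
move=> /[swap] /[apply] xM.
have : Num.max `|x.1| `|x.2| <= `|M| + 1 by exact: xM.
rewrite ge_max => /andP[? ?].
exact/boxE.
Qed.

Lemma continuous_bounded_box f M : continuous f ->
  exists2 C, 0 <= C & forall x, box M x -> `|f x| <= C.
Proof.
move=> cf; have : compact (f @` box M).
  by apply: continuous_compact; [exact: continuous_subspaceT|exact: compact_box].
move=> /compact_bounded[C [_ HC]]; exists (`|C| + 1); first by rewrite addr_ge0.
move=> x Bx; apply: HC; last by exists x.
by rewrite (le_lt_trans (ler_norm _))// ltrDl.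
Qed.

Lemma integrable_box f M : continuous f -> area.-integrable (box M) (EFin \o f).
Proof.
move=> cf; apply: measurable_bounded_integrable.
- exact: measurable_box.
- exact: area_box_fin.
- exact: continuous_measurable2 (measurable_box M) cf.
- have [C C0 HC] := continuous_bounded_box f M cf.
  exists C; split; rewrite ?num_real// => K CK x Bx.
  exact: le_trans (HC _ Bx) (ltW CK).
Qed.

Lemma patch_box f M : (forall x, ~ box M x -> f x = 0) -> f \_ (box M) = f.
Proof.
move=> f0; apply/funext => x; rewrite patchE; case: ifPn => // /negP xM.
by rewrite f0// => Bx; apply: xM; rewrite inE.
Qed.

Lemma integrable_csupp f M : continuous f -> (forall x, ~ box M x -> f x = 0) ->
  area.-integrable setT (EFin \o f).
Proof.
move=> cf f0; have := integrable_box f M cf.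
move=> H; have := (integrable_mkcond _ (measurable_box M)).1 H.
by rewrite restrict_EFin patch_box.
Qed.

(** The complement of a closed set is open, so near a point off [A] the
    function is identically 0. *)
Lemma derive_outside f A v x : closed A -> (forall x, ~ A x -> f x = 0) -> ~ A x ->
  'D_v (f : R * R -> R^o) x = 0.
Proof.
move=> cA f0 nAx; rewrite (@near_eq_derive _ _ _ _ (cst 0)) ?derive_cst//.
have : nbhs x (~` A) by apply: open_nbhs_nbhs; split=> //; exact: closed_openC.
by apply: filterS => y /= nAy; exact: f0.
Qed.

Lemma integral_derive1_csupp (g g' : R -> R) M : 0 <= M ->
  (forall t : R, is_derive t 1 g (g' t)) -> continuous g' ->
  (forall t : R, M < `|t| -> g t = 0) ->
  (\int[@lebesgue_measure R]_t (g' t)%:E = 0)%E.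
Proof.
move=> M0 dg cg' g0.
have M1 : - (M + 1) < M + 1 by lra.
have cg : continuous g.
  move=> t; apply/differentiable_continuous/derivable1_diffP.
  by case: (dg t).
have := @continuous_FTC2 R g' g _ _ M1.
have -> : g (M + 1) = 0 by apply: g0; rewrite ger0_norm; lra.
have -> : g (- (M + 1)) = 0 by apply: g0; rewrite normrN ger0_norm; lra.
rewrite sube0 => FTC; rewrite -[RHS]/(0%:E) -{}FTC.
- rewrite [RHS]integral_mkcond; apply: eq_integral => t _.
  rewrite restrict_EFin/= patchE; case: ifPn => // /negP tM.
  case: (dg t) => _ <-.
  rewrite (@near_eq_derive _ _ _ _ (cst 0)) ?derive_cst//.
  have tM1 : M < `|t|.
    rewrite ltNge; apply/negP => tM'; apply: tM; rewrite inE/= in_itv/=.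
    by move: tM'; rewrite ler_norml => /andP[? ?]; apply/andP; split; lra.
  have : nbhs t [set s : R | M < `|s|].
    apply: open_nbhs_nbhs; split=> //.
    apply: (@open_comp _ _ (fun s : R => `|s|) [set s | M < s]); last exact: open_gt.
    by move=> ? _; exact: norm_continuous.
  by apply: filterS => s /g0.
- exact: continuous_subspaceT.
- split.
  + by move=> t _; case: (dg t).
  + by apply: cvg_at_right_filter; exact: cg.
  + by apply: cvg_at_left_filter; exact: cg.
- by move=> t _; rewrite derive1E; case: (dg t).
Qed.

(** Integrate first along the lines parallel to the x-axis; there the
    fundamental theorem of calculus leaves only boundary values outside the
    support. *)
Lemma integral_dx_csupp f M : Cn 1 f -> (forall x, ~ box M x -> f x = 0) ->
  (\int[area]_x (dx f x)%:E = 0)%E.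
Proof.
move=> Cf f0; have cdx := Cn_continuous _ _ (Cn_dx _ _ Cf).
have f'0 x : ~ box M x -> dx f x = 0 by apply: derive_outside => //; exact: closed_box.
rewrite -integral21_prod_meas1; last exact: (integrable_csupp (dx f) M cdx f'0).
apply: integral0_eq => y _.
apply: (integral_derive1_csupp (fun t => f (t, y)) (fun t => dx f (t, y)) `|M|) => //.
- by move=> t; apply/slice_dx; exact: (Cn_is_dx 0).
- move=> t; apply: (@continuous_comp _ _ _ (fun t => (t, y)) (dx f)); last exact: cdx.
  by apply: (@cvg_pair _ _ _ (nbhs t) (nbhs t) (nbhs y) _ _ _ id (fun=> y));
    [exact: cvg_id|exact: cvg_cst].
- move=> t tM; apply: f0 => /boxE[/= tM' _].
  by have := lt_le_trans tM (le_trans tM' (ler_norm _)); rewrite ltxx.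
Qed.

Lemma integral_dy_csupp f M : Cn 1 f -> (forall x, ~ box M x -> f x = 0) ->
  (\int[area]_x (dy f x)%:E = 0)%E.
Proof.
move=> Cf f0; have cdy := Cn_continuous _ _ (Cn_dy _ _ Cf).
have f'0 x : ~ box M x -> dy f x = 0 by apply: derive_outside => //; exact: closed_box.
rewrite -integral12_prod_meas1; last exact: (integrable_csupp (dy f) M cdy f'0).
apply: integral0_eq => y _.
apply: (integral_derive1_csupp (fun t => f (y, t)) (fun t => dy f (y, t)) `|M|) => //.
- by move=> t; apply/slice_dy; exact: (Cn_is_dy 0).
- move=> t; apply: (@continuous_comp _ _ _ (fun t => (y, t)) (dy f)); last exact: cdy.
  by apply: (@cvg_pair _ _ _ (nbhs t) (nbhs y) (nbhs t) _ _ _ (fun=> y) id);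
    [exact: cvg_cst|exact: cvg_id].
- move=> t tM; apply: f0 => /boxE[_ /= tM'].
  by have := lt_le_trans tM (le_trans tM' (ler_norm _)); rewrite ltxx.
Qed.

End PlaneMeasure.

(** * Barycentric coordinates and open triangles *)

Section Triangle.
Context {R : realType}.
Context {M : mesh R}.
Implicit Types (T : 'I_(nelt M)) (x y z : R * R) (i : 'I_3).

Local Notation area := (@lebesgue_measure R \x @lebesgue_measure R)%E.
Local Notation plane := (measurableTypeR R * measurableTypeR R)%type.

(** Twice the signed area of the triangle. *)
Definition elem_det T : R :=
  ((vtx T 1).1 - (vtx T 0).1) * ((vtx T 2).2 - (vtx T 0).2) -
  ((vtx T 1).2 - (vtx T 0).2) * ((vtx T 2).1 - (vtx T 0).1).

(** Explicit form: the ratio of the signed area of the triangle spanned by the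
    point and the edge opposite to vertex [i] to that of [T].  Being an affine
    function by construction, it composes with [flat] to a smooth function. *)
Definition bary T i : R * R -> R :=
  let p := vtx T (ordS i) in let q := vtx T (ord_pred i) in
  affine ((p.2 - q.2) / elem_det T) ((q.1 - p.1) / elem_det T)
    ((p.1 * q.2 - p.2 * q.1) / elem_det T).

Lemma ord3_ind (P : 'I_3 -> Prop) : P 0 -> P 1 -> P 2 -> forall i, P i.
Proof.
move=> P0 P1 P2 [[|[|[|//]]] h].
- by have -> : Ordinal h = 0 by exact: val_inj.
- by have -> : Ordinal h = 1 by exact: val_inj.
- by have -> : Ordinal h = 2 by exact: val_inj.
Qed.

Lemma ordS3E : (ordS (0 : 'I_3) = 1) * (ordS (1 : 'I_3) = 2) * (ordS (2 : 'I_3) = 0) *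
  (ord_pred (0 : 'I_3) = 2) * (ord_pred (1 : 'I_3) = 0) * (ord_pred (2 : 'I_3) = 1).
Proof. by do !split; apply: val_inj. Qed.

Lemma sum3 (V : zmodType) (F : 'I_3 -> V) : \sum_i F i = F 0 + F 1 + F 2.
Proof.
rewrite !big_ord_recr big_ord0 /= add0r; congr (F _ + F _ + F _); exact: val_inj.
Qed.

(** Barycentric coordinates of a point are unique, by Cramer's rule. *)
Lemma bary_comb T (l : 'I_3 -> R) i : Defs.nondegenerate T -> \sum_j l j = 1 ->
  bary T i (\sum_j l j *: vtx T j) = l i.
Proof.
rewrite /Defs.nondegenerate /= => d0; rewrite !sum3 => l1.
have d0' : elem_det T != 0 by [].
have -> : l i = (l 0 + l 1 + l 2) * l i by rewrite l1 mul1r.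
rewrite /bary /affine.
have E : (l 0 *: vtx T 0 + l 1 *: vtx T 1 + l 2 *: vtx T 2).1 =
  l 0 * (vtx T 0).1 + l 1 * (vtx T 1).1 + l 2 * (vtx T 2).1 by [].
have E' : (l 0 *: vtx T 0 + l 1 *: vtx T 1 + l 2 *: vtx T 2).2 =
  l 0 * (vtx T 0).2 + l 1 * (vtx T 1).2 + l 2 * (vtx T 2).2 by [].
rewrite E E' {E E'}.
have l0 : l 0 = 1 - l 1 - l 2 by rewrite -l1; ring.
by move: i d0'; apply: ord3_ind; rewrite !ordS3E /elem_det l0 => d0'; field.
Qed.

Lemma bary_vtx T i j : Defs.nondegenerate T -> bary T i (vtx T j) = (i == j)%:R.
Proof.
move=> nT; have -> : vtx T j = \sum_k ((k == j)%:R : R) *: vtx T k.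
  by rewrite (bigD1 j)//= eqxx scale1r big1 ?addr0// => k /negPf ->; rewrite scale0r.
rewrite bary_comb//.
by rewrite (bigD1 j)//= eqxx big1 ?addr0// => k /negPf ->.
Qed.

Lemma bary_sum T x : Defs.nondegenerate T -> \sum_i bary T i x = 1.
Proof.
move=> nT; have d0 : elem_det T != 0 by [].
by move: d0; rewrite sum3 /bary /affine !ordS3E /elem_det => d0; field.
Qed.

Lemma bary_repr T x : Defs.nondegenerate T -> \sum_i bary T i x *: vtx T i = x.
Proof.
move=> nT; have d0 : elem_det T != 0 by [].
rewrite sum3 [RHS]surjective_pairing [LHS]surjective_pairing; congr (_, _).
- rewrite [LHS](_ : _ = bary T 0 x * (vtx T 0).1 + bary T 1 x * (vtx T 1).1 +
    bary T 2 x * (vtx T 2).1)//.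
  by move: d0; rewrite /bary /affine !ordS3E /elem_det => d0; field.
- rewrite [LHS](_ : _ = bary T 0 x * (vtx T 0).2 + bary T 1 x * (vtx T 1).2 +
    bary T 2 x * (vtx T 2).2)//.
  by move: d0; rewrite /bary /affine !ordS3E /elem_det => d0; field.
Qed.

Lemma elemE T x : Defs.nondegenerate T -> elem T x <-> forall i, 0 <= bary T i x.
Proof.
move=> nT; split=> [[l [l0 l1 ->]] i|x0]; first by rewrite bary_comb.
by exists (bary T ^~ x); split=> //; [exact: bary_sum|rewrite bary_repr].
Qed.

(** The points with positive barycentric coordinates.  This description of the
    interior gives the cutoff functions and the disjointness directly. *)
Definition open_elem T : set (R * R) := [set x | forall i, 0 < bary T i x].

Lemma continuous_bary T i : continuous (bary T i).
Proof. exact: continuous_affine. Qed.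

Lemma open_open_elem T : open (open_elem T).
Proof.
have oi i : open [set x | 0 < bary T i x].
  by apply: (@open_comp _ _ (bary T i) [set r | 0 < r]);
    [move=> ? _; exact: continuous_bary|exact: open_gt].
have -> : open_elem T = [set x | 0 < bary T 0 x] `&` [set x | 0 < bary T 1 x]
    `&` [set x | 0 < bary T 2 x].
  apply/seteqP; split=> [x xT|x [[? ?] ?]]; first by split; [split|]; exact: xT.
  by apply: ord3_ind.
by apply: openI; [exact: openI|].
Qed.

Lemma open_elem_interior T : Defs.nondegenerate T -> open_elem T `<=` (elem T)°.
Proof.
move=> nT; rewrite -open_subsetE; last exact: open_open_elem.
by move=> x xT; apply/elemE => // i; exact: ltW.
Qed.

Lemma bary_line T i x y (t : R) :
  bary T i (x + t *: (y - x)) = (1 - t) * bary T i x + t * bary T i y.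
Proof.
rewrite /bary /affine.
have -> : (x + t *: (y - x)).1 = x.1 + t * (y.1 - x.1) by [].
have -> : (x + t *: (y - x)).2 = x.2 + t * (y.2 - x.2) by [].
ring.
Qed.

(** Move from [x] slightly towards the centroid [z]: the barycentric coordinates
    become positive, and the point stays in [U]. *)
Lemma open_elem_meets T U x : Defs.nondegenerate T -> open U -> U x -> elem T x ->
  (open_elem T `&` U) !=set0.
Proof.
move=> nT oU Ux /(elemE _ _ nT) x0.
pose z := \sum_i (3^-1 : R) *: vtx T i.
have z0 i : 0 < bary T i z.
  by rewrite bary_comb ?invr_gt0//; rewrite sum3; field.
have : (fun t : R => x + t *: (z - x)) t @[t --> (0:R)] --> x + 0 *: (z - x).
  by apply: cvgD; [exact: cvg_cst|apply: cvgZr_tmp; exact: cvg_id].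
rewrite scale0r addr0 => /(_ U) /(_ (open_nbhs_nbhs (conj oU Ux))) nU.
have {}/nbhs_ballP[e /= e0 eU] : \forall t \near (0:R), U (x + t *: (z - x)) by [].
pose t := Num.min (e / 2) 2^-1.
have t0 : 0 < t by rewrite lt_min divr_gt0//= invr_gt0.
have te : t < e.
  by rewrite gt_min; apply/orP; left; rewrite ltr_pdivrMr// ltr_pMr// ltr1n.
have t1 : t < 1.
  by rewrite gt_min; apply/orP; right; rewrite invf_lt1// ltr1n.
exists (x + t *: (z - x)); split; last first.
  by apply: eU; rewrite /ball/= sub0r normrN gtr0_norm.
move=> i; rewrite bary_line ltr_wpDl// ?mulr_gt0// mulr_ge0// subr_ge0 ltW//.
Qed.

Lemma open_elem_vtx T i : Defs.nondegenerate T -> ~ open_elem T (vtx T i).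
Proof.
move=> nT /(_ (ordS i)); rewrite bary_vtx//.
by move: i; apply: ord3_ind; rewrite ordS3E ltxx.
Qed.

Lemma open_elem_edge T i x : Defs.nondegenerate T -> edge T i x -> ~ open_elem T x.
Proof.
move=> nT [t _ <-] /(_ i).
have -> : (1 - t) *: vtx T (ordS i) + t *: vtx T (ord_pred i) =
  vtx T (ordS i) + t *: (vtx T (ord_pred i) - vtx T (ordS i)).
  by rewrite scalerBl scalerBr scale1r -addrA; congr (_ + _); rewrite addrC.
rewrite bary_line !bary_vtx//.
by move: i; apply: ord3_ind; rewrite !ordS3E /= !mulr0 addr0 ltxx.
Qed.

(** By conformity the intersection of two distinct elements is empty, a vertex
    or an edge of [T], and one of the barycentric coordinates of [T] vanishes
    there. *)
Lemma open_elem_disjoint T T' x : conforming M ->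
  (forall T, Defs.nondegenerate T) -> open_elem T x -> open_elem T' x -> T = T'.
Proof.
move=> cM nM xT xT'; apply/eqP/negPn/negP => /cM TT'.
have xTT' : (elem T `&` elem T') x.
  by split; apply: interior_subset; exact: open_elem_interior.
case: TT' => [E|[i [i' [E _]]]|[i [i' [E _]]]]; rewrite E in xTT'.
- by [].
- by apply: (open_elem_vtx T i (nM T)); rewrite -xTT'.
- exact: open_elem_edge (nM T) xTT' xT.
Qed.

(** A line that is not vertical meets each vertical line in at most one point,
    and a vertical line meets each horizontal one in at most one point; Fubini
    in the appropriate order gives measure 0. *)
Lemma affine_null (a b c : R) : (a != 0) || (b != 0) ->
  area [set x | affine a b c x = 0] = 0%E.
Proof.
move=> ab; set N := (X in area X).
have cN : closed N.
  have -> : N = affine a b c @^-1` [set 0] by [].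
  by apply: closed_comp; [move=> ? _; exact: continuous_affine|exact: closed_eq].
have mN : measurable (N : set plane) by exact: closed_measurable2.
have mf : measurable_fun setT (fun x : plane => (\1_N x : R)%:E).
  by apply/measurable_EFinP; exact: measurable_indic.
rewrite -[N]setIT -integral_indic//.
have sec (A : set R) r : A `<=` [set r] ->
    (\int[@lebesgue_measure R]_x (\1_A x : R)%:E = 0)%E.
  move=> /subset_set1[] ->.
    by rewrite integral_indic// setIT measure0.
  have mr : measurable ([set r] : set (measurableTypeR R)) by exact: measurable_set1.
  by rewrite integral_indic// setIT; exact: lebesgue_measure_set1.
have [b0|b0] := eqVneq b 0.
  rewrite b0 eqxx orbF in ab.
  rewrite fubini_tonelli2//; apply: integral0_eq => y _.
  apply: (sec [set x | N (x, y)] (- (b * y + c) / a)) => x; rewrite /N /affine /= => E.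
  by apply: (mulfI ab); rewrite [RHS]mulrC divfK//; lra.
rewrite fubini_tonelli1//; apply: integral0_eq => y _.
apply: (sec [set x | N (y, x)] (- (a * y + c) / b)) => x; rewrite /N /affine /= => E.
by apply: (mulfI b0); rewrite [RHS]mulrC divfK//; lra.
Qed.

Lemma elem_skeleton_negligible T : Defs.nondegenerate T ->
  area.-negligible (elem T `\` open_elem T).
Proof.
move=> nT.
have sub : elem T `\` open_elem T `<=`
    \bigcup_(i in [set: 'I_3]) [set x | bary T i x = 0].
  move=> x [/elemE - /(_ nT) x0 nx]; apply: contrapT => nz; apply: nx => i.
  by rewrite lt_neqAle x0 andbT; apply/eqP => E; apply: nz; exists i.
have N0 i : area.-negligible [set x | bary T i x = 0].
  exists [set x | bary T i x = 0]; split=> //.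
    apply: closed_measurable2.
    have -> : [set x | bary T i x = 0] = bary T i @^-1` [set 0] by [].
    by apply: closed_comp; [move=> ? _; exact: continuous_bary|exact: closed_eq].
  apply: affine_null; apply: contraPT (bary_vtx T i i nT).
  rewrite negb_or !negbK => /andP[/eqP a0 /eqP b0] E.
  have := bary_vtx T i (ordS i) nT; move: E.
  rewrite /bary a0 b0 /affine !mul0r !add0r => -> /eqP.
  by rewrite eqxx /=; move: {a0 b0} i; apply: ord3_ind; rewrite ordS3E /= oner_eq0.
have [A [mA A0 sA]] : area.-negligible ([set x | bary T 0 x = 0] `|`
    [set x | bary T 1 x = 0] `|` [set x | bary T 2 x = 0]).
  by apply: negligibleU; [exact: negligibleU|].
exists A; split=> // x /sub[i _]; move: i; apply: ord3_ind => xi; apply: sA.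
- by left; left.
- by left; right.
- by right.
Qed.

End Triangle.

(** * From elementwise to distributional divergence *)

Section WeakDivergence.
Context {R : realType}.
Context {M : mesh R}.
Implicit Types (T : 'I_(nelt M)) (x y z : R * R) (D K : set (R * R)).

Local Notation area := (@lebesgue_measure R \x @lebesgue_measure R)%E.
Local Notation plane := (measurableTypeR R * measurableTypeR R)%type.

(** A smooth function of [t] that vanishes for t <= 1/(n+1), takes values in
    [0, 1], and tends to 1 as n grows for each t > 0. *)
Definition ramp (n : nat) (t : R) : R := flat 1 (n.+1%:R * t - 1).

Lemma ramp_bound n t : 0 <= ramp n t <= 1.
Proof.
rewrite /ramp /flat; case: ifPn => [t0|_]; last by rewrite lexx ler01.
rewrite !hornerE expR_ge0/= -[leRHS]expR0 ler_expR oppr_le0 invr_ge0.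
exact: ltW.
Qed.

Lemma ramp0 n t : t <= n.+1%:R^-1 -> ramp n t = 0.
Proof.
move=> tn; rewrite /ramp /flat ifF//; apply/negbTE; rewrite -leNgt subr_le0.
by rewrite -ler_pdivlMl ?ltr0n// mulr1.
Qed.

Lemma ramp_cvg (t : R) : 0 < t -> ramp n t @[n --> \oo] --> (1 : R).
Proof.
move=> t0.
have ty : (fun n => n.+1%:R * t - 1 : R) @ \oo --> +oo.
  apply/cvgryPge => A; near=> n.
  rewrite lerBrDr -ler_pdivrMr//.
  have : (A + 1) / t <= n%:R by near: n; exact: nbhs_infty_ger.
  by move/le_trans; apply; rewrite ler_nat.
have inv0 : (fun n => (n.+1%:R * t - 1)^-1 : R) @ \oo --> (0 : R).
  by apply/gtr0_cvgV0 => //; move/cvgryPgt : ty; apply.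
have : (fun n => expR (- (n.+1%:R * t - 1)^-1) : R) @ \oo --> expR (- 0).
  by apply: (cvg_comp _ _ (cvgN inv0)); exact: continuous_expR.
rewrite oppr0 expR0; apply: cvg_trans; apply: near_eq_cvg; near=> n.
rewrite /ramp /flat ifT ?hornerE//.
by near: n; move/cvgryPgt : ty; apply.
Unshelve. all: by end_near. Qed.

(** As a product over the three barycentric coordinates, it vanishes as soon as
    one of them is at most 1/(n+1), i.e. near and beyond the edges of [T]. *)
Definition cutoff T (n : nat) x : R :=
  ramp n (bary T 0 x) * ramp n (bary T 1 x) * ramp n (bary T 2 x).

Lemma Cn_cutoff T n m : Cn m (cutoff T n).
Proof.
have H (i : 'I_3) : Cn m (fun x => ramp n (bary T i x)).
  rewrite /ramp /bary.
  set a := (_ / _); set b := (_ / _); set c := (_ / _).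
  have -> : (fun x => flat 1 (n.+1%:R * affine a b c x - 1)) =
    (fun x => flat 1 (affine (n.+1%:R * a) (n.+1%:R * b) (n.+1%:R * c - 1) x)).
    by apply/funext => x; congr flat; rewrite /affine; ring.
  exact: Cn_flat.
by apply: CnM; first apply: CnM.
Qed.

Lemma cutoff_bound T n x : `|cutoff T n x| <= 1.
Proof.
have H i : 0 <= ramp n (bary T i x) <= 1 := ramp_bound _ _.
rewrite /cutoff !normrM; have N i : `|ramp n (bary T i x)| <= 1.
  by case/andP: (H i) => h0 h1; rewrite ger0_norm.
by rewrite !mulr_ile1 ?mulr_ge0.
Qed.

Lemma cutoff_cvg T x : open_elem T x -> cutoff T n x @[n --> \oo] --> (1 : R).
Proof.
move=> xT; suff : cutoff T n x @[n --> \oo] --> (1 * 1 * 1 : R) by rewrite !mulr1.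
by apply: cvgM; [apply: cvgM|]; exact: ramp_cvg.
Qed.

(** The closed smaller triangle that carries the cutoff function. *)
Definition core T (n : nat) : set (R * R) := [set x | forall i, n.+1%:R^-1 <= bary T i x].

Lemma cutoff_out T n x : ~ core T n x -> cutoff T n x = 0.
Proof.
move=> nx; suff [i xi] : exists i, ramp n (bary T i x) = 0.
  rewrite /cutoff; move: i xi; apply: ord3_ind => ->; rewrite ?mulr0 ?mul0r//.
apply: contrapT => nz; apply: nx => i; rewrite leNgt; apply/negP => xi.
by apply: nz; exists i; apply: ramp0; exact: ltW.
Qed.

Lemma core_sub T n : core T n `<=` open_elem T.
Proof. by move=> x xT i; apply: lt_le_trans (xT i); rewrite invr_gt0. Qed.

Lemma closed_core T n : closed (core T n).
Proof.
have ci i : closed [set x | n.+1%:R^-1 <= bary T i x].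
  by apply: (@closed_comp _ _ (bary T i) [set r | n.+1%:R^-1 <= r]);
    [move=> ? _; exact: continuous_bary|exact: closed_ge].
have -> : core T n = [set x | n.+1%:R^-1 <= bary T 0 x]
    `&` [set x | n.+1%:R^-1 <= bary T 1 x] `&` [set x | n.+1%:R^-1 <= bary T 2 x].
  apply/seteqP; split=> [x xT|x [[? ?] ?]]; first by split; [split|]; exact: xT.
  by apply: ord3_ind.
by apply: closedI; [exact: closedI|].
Qed.

Lemma test_function_cutoff D phi T n : test_function D phi ->
  open_elem T `<=` D ->
  test_function D (fun x => phi x * cutoff T n x).
Proof.
move=> [Cphi [K [cK KD phi0]]] TD; split.
  by move=> m; apply: CnM; [exact: Cphi|exact: Cn_cutoff].
exists (K `&` core T n); split.
- apply: (subclosed_compact _ cK); last exact: subIsetl.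
  apply: closedI; last exact: closed_core.
  by apply: compact_closed => //; exact: norm_hausdorff.
- by move=> x [Kx _]; exact: KD.
- move=> x nx; have [Kx|nKx] := pselect (K x); last by rewrite phi0 ?mul0r.
  by rewrite cutoff_out ?mulr0// => cx; apply: nx.
Qed.

(** For a divergence-free field v the product rule gives
    v . grad psi = div (psi v), whose integral vanishes because psi has compact
    support. *)
Lemma integral_dot_grad_csupp (v1 v2 psi : R * R -> R) (B : R) : Cn 1 v1 -> Cn 1 v2 ->
  Cn 1 psi -> (forall x, ~ box B x -> psi x = 0) ->
  (forall x, dx v1 x + dy v2 x = 0) ->
  (\int[area]_x (v1 x * dx psi x + v2 x * dy psi x)%:E = 0)%E.
Proof.
move=> C1 C2 Cp p0 div0.
have C1p := CnM 1 _ _ C1 Cp; have C2p := CnM 1 _ _ C2 Cp.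
have E x : v1 x * dx psi x + v2 x * dy psi x =
    dx (fun x => v1 x * psi x) x + dy (fun x => v2 x * psi x) x.
  have [_ E1] := is_derive_funM _ _ x _ _ _ (Cn_is_dx 0 v1 x C1) (Cn_is_dx 0 psi x Cp).
  have [_ E2] := is_derive_funM _ _ x _ _ _ (Cn_is_dy 0 v2 x C2) (Cn_is_dy 0 psi x Cp).
  have -> : dx (fun x => v1 x * psi x) x = dx v1 x * psi x + v1 x * dx psi x := E1.
  have -> : dy (fun x => v2 x * psi x) x = dy v2 x * psi x + v2 x * dy psi x := E2.
  by rewrite addrACA -mulrDl div0 mul0r add0r.
under eq_integral do rewrite E EFinD.
have z1 x : ~ box B x -> v1 x * psi x = 0 by move=> /p0 ->; rewrite mulr0.
have z2 x : ~ box B x -> v2 x * psi x = 0 by move=> /p0 ->; rewrite mulr0.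
rewrite integralD//=.
- by rewrite (integral_dx_csupp _ B C1p z1) (integral_dy_csupp _ B C2p z2) adde0.
- apply: (integrable_csupp (dx (fun x => v1 x * psi x)) B).
    exact: Cn_continuous (Cn_dx _ _ C1p).
  by move=> x; apply: derive_outside => //; exact: closed_box.
- apply: (integrable_csupp (dy (fun x => v2 x * psi x)) B).
    exact: Cn_continuous (Cn_dy _ _ C2p).
  by move=> x; apply: derive_outside => //; exact: closed_box.
Qed.

(** The cutoff confines the integrand to [T], where [u] may be replaced by the
    smooth field [(v1, v2)] defined on the whole plane. *)
Lemma integral_dot_grad_cutoff0 D u phi T n (v1 v2 : R * R -> R) :
  test_function D phi -> open_elem T `<=` D ->
  Cn 1 v1 -> Cn 1 v2 -> (forall x, open_elem T x -> u x = (v1 x, v2 x)) ->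
  (forall x, dx v1 x + dy v2 x = 0) ->
  let psi := fun x => phi x * cutoff T n x in
  \int[area]_(x in D) ((u x).1 * dx psi x + (u x).2 * dy psi x) = 0.
Proof.
move=> tphi TD C1 C2 uv div0 psi.
have [Cphi [K [cK KD phi0]]] := tphi.
have [Cpsi _] := test_function_cutoff _ _ T n tphi TD.
have psi0 x : ~ core T n x -> psi x = 0.
  by move=> xT; rewrite /psi cutoff_out// mulr0.
have dx0 x : ~ core T n x -> dx psi x = 0.
  by apply: derive_outside => //; exact: closed_core.
have dy0 x : ~ core T n x -> dy psi x = 0.
  by apply: derive_outside => //; exact: closed_core.
have [B B0 KB] := bounded_box _ (compact_bounded cK).
rewrite Rintegral_mkcond /Rintegral.
rewrite [X in fine X](_ : _ = 0%E)//.
rewrite -[RHS](integral_dot_grad_csupp v1 v2 psi B) //; last first.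
  by move=> x xB; rewrite /psi phi0 ?mul0r// => /KB.
apply: eq_integral => x _ /=; rewrite patchE.
have [xc|xc] := pselect (core T n x).
  have xT := core_sub _ _ _ xc.
  by rewrite mem_set ?uv//; exact: TD.
by rewrite dx0// dy0// !mulr0 addr0 if_same.
Qed.

(** On a box that contains the support of [phi], |g phi| <= C (g^2 + 1), and
    outside of it the product vanishes. *)
Lemma integrable_L2_test D (g phi : R * R -> R) : measurable (D : set plane) ->
  L2 D g -> test_function D phi ->
  area.-integrable (D : set plane) (fun x : plane => (g x * phi x)%:E).
Proof.
move=> mD [mg ig] [Cphi [K [cK KD phi0]]].
have {}mg : measurable_fun (D : set plane) (g : plane -> R) by exact: mg.
have [B B0 KB] := bounded_box _ (compact_bounded cK).
have cphi := Cn_continuous _ _ (Cphi 0).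
have [C C0 HC] := continuous_bounded_box phi B cphi.
have mphi := continuous_measurable2 phi D mD cphi.
pose one : plane -> R := (fun=> (1 : R)) \_ (box B).
have i1 : area.-integrable (D : set plane) (EFin \o one).
  apply: (integrableS measurableT mD) => //.
  rewrite /one -restrict_EFin; apply/(integrable_mkcond _ (measurable_box B)).
  by apply: (integrable_box (fun=> 1) B); exact: cst_continuous.
have i2 : area.-integrable (D : set plane) (fun x : plane => (g x ^+ 2)%:E).
  apply/integrableP; split.
    by apply/measurable_EFinP; exact: measurable_funX.
  by under eq_integral do rewrite gee0_abs ?lee_fin ?sqr_ge0//.
have ih : area.-integrable (D : set plane)
    (fun x : plane => (C%:E * ((g x ^+ 2)%:E + (one x)%:E))%E).
  by apply: integrableZl => //; exact: integrableD.
apply: le_integrable ih => //.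
  by apply/measurable_EFinP; exact: measurable_funM.
move=> x Dx; rewrite [leRHS]/= [leLHS]/= lee_fin.
rewrite [leRHS]ger0_norm; last first.
  by rewrite mulr_ge0// addr_ge0 ?sqr_ge0// /one patchE; case: ifP.
have [xB|xB] := pselect (box B x); last first.
  rewrite phi0; last by move=> /KB.
  by rewrite mulr0 normr0 mulr_ge0// addr_ge0 ?sqr_ge0// /one patchE; case: ifP.
rewrite /one patchE mem_set// normrM mulrC ler_pM// ?HC//.
rewrite -[g x ^+ 2]real_normK ?num_real//.
(* a <= a^2 + 1 follows from (a - 1/2)^2 >= 0. *)
set a := `|g x|; have : 0 <= (a - 2^-1) ^+ 2 by exact: sqr_ge0.
by rewrite expr2; nra.
Qed.

(** The products of [phi] with the cutoff functions are test functions on [D], so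
    the weak identity applies to each of them, whereas the integral over a
    single element is only reached in the limit. *)
Lemma integral_open_elem0 D u g phi T (v1 v2 : R * R -> R) : open D ->
  is_L2_div D u g -> test_function D phi -> open_elem T `<=` D ->
  Cn 1 v1 -> Cn 1 v2 -> (forall x, open_elem T x -> u x = (v1 x, v2 x)) ->
  (forall x, dx v1 x + dy v2 x = 0) ->
  (\int[area]_(x in open_elem T) (g x * phi x)%:E = 0)%E.
Proof.
move=> oD [Lg wg] tphi TD C1 C2 uv div0.
have mD := open_measurable2 _ oD.
have mT : measurable (open_elem T : set plane).
  by apply: open_measurable2; exact: open_open_elem.
pose psi n x := phi x * cutoff T n x.
have tpsi n : test_function D (psi n) by exact: test_function_cutoff.
have ipsi n := integrable_L2_test _ _ _ mD Lg (tpsi n).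
have iphi := integrable_L2_test _ _ _ mD Lg tphi.
have int0 n : (\int[area]_(x in open_elem T) (g x * psi n x)%:E = 0)%E.
  transitivity (\int[area]_(x in (D : set plane)) (g x * psi n x)%:E)%E.
    rewrite integral_mkcond [RHS]integral_mkcond; apply: eq_integral => x _.
    rewrite !patchE; case: ifPn => xT.
      by rewrite ifT// mem_set//; apply: TD; rewrite inE in xT.
    rewrite /psi cutoff_out; first by rewrite !mulr0 if_same.
    by move=> /core_sub xT'; rewrite mem_set in xT.
  rewrite -[LHS]fineK; last exact: integrable_fin_num (ipsi n).
  congr (_%:E).
  have := wg _ (tpsi n).
  rewrite (integral_dot_grad_cutoff0 D u phi T n v1 v2)// => /eqP.
  by rewrite eq_sym oppr_eq0 => /eqP.
pose f_ n (x : plane) := (g x * psi n x)%:E.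
pose f (x : plane) := (g x * phi x)%:E.
have iT h : area.-integrable (D : set plane) h ->
    area.-integrable (open_elem T : set plane) h.
  exact: integrableS.
have mf_ n : measurable_fun (open_elem T : set plane) (f_ n).
  by apply: measurable_int (iT _ (ipsi n)).
have mf : measurable_fun (open_elem T : set plane) f.
  by apply: measurable_int (iT _ iphi).
have f_f : {ae area, forall x, open_elem T x -> f_ ^~ x @ \oo --> f x}.
  apply: aeW => x xT; apply: cvg_EFin; first by near=> n.
  have H : g x * phi x * cutoff T n x @[n --> \oo] --> (g x * phi x * 1 : R).
    by apply: cvgM; [exact: cvg_cst|exact: cutoff_cvg].
  rewrite mulr1 in H; apply: cvg_trans H; apply: near_eq_cvg; near=> n.
  by rewrite /f_ /psi /= mulrA.
have f_b : {ae area, forall x n, open_elem T x -> (`|f_ n x| <= `|f x|)%E}.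
  apply: aeW => x n xT; rewrite /f_ /f /psi lee_fin mulrA normrM.
  by rewrite ler_piMr ?cutoff_bound.
have [_ _ lim] := dominated_convergence mT mf_ mf f_f (integrable_abse (iT _ iphi)) f_b.
apply/esym/(cvg_unique _ _ lim) => //.
rewrite (_ : (fun n => _) = cst 0%E); first exact: cvg_cst.
by apply/funext => n; exact: int0.
Unshelve. all: by end_near. Qed.

(** The open triangles cover the domain up to a null set and are disjoint, so
    the elementwise identities [integral_open_elem0] add up. *)
Lemma weak_div_eq0 (ndM : forall T : 'I_(nelt M), Defs.nondegenerate T)
    (cfM : conforming M) (Act : set 'I_(nelt M)) u g :
  let D := (\bigcup_(T in Act) elem T)° in
  is_L2_div D u g ->
  (forall T, Act T -> exists v1 v2, [/\ Cn 1 v1, Cn 1 v2,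
     forall x, open_elem T x -> u x = (v1 x, v2 x) &
     forall x, dx v1 x + dy v2 x = 0]) ->
  is_L2_div D u (fun=> 0).
Proof.
move=> D wg uT; have [Lg eg] := wg.
have oD : open D by exact: open_interior.
have mD := open_measurable2 _ oD.
have TD T : Act T -> open_elem T `<=` D.
  move=> aT; rewrite -open_subsetE; last exact: open_open_elem.
  by move=> x /(open_elem_interior T (ndM T))/interior_subset xT; exists T.
split.
  split; first exact: measurable_cst.
  under eq_integral do rewrite expr0n /=.
  by rewrite integral0 ltry.
move=> phi tphi; rewrite eg//; congr (- _).
have iphi := integrable_L2_test _ _ _ mD Lg tphi.
under [RHS]eq_Rintegral do rewrite mul0r.
rewrite /Rintegral integral0; congr fine.
pose s := [seq T <- enum 'I_(nelt M) | `[< Act T >]].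
have sE T : T \in s = `[< Act T >] by rewrite mem_filter mem_enum andbT.
pose D' : set plane := \big[setU/set0]_(T <- s) open_elem T.
have D'E : D' = \bigcup_(T in Act) open_elem T.
  rewrite /D' -bigcup_seq; apply/seteqP; split=> x [T aT xT]; exists T => //.
    by apply/asboolP; rewrite -sE.
  by have : T \in s by rewrite sE; apply/asboolP.
have mT T : measurable (open_elem T : set plane).
  by apply: open_measurable2; exact: open_open_elem.
have mD' : measurable D' by apply: bigsetU_measurable.
have D'D : D' `<=` D by rewrite D'E => x [T aT xT]; exact: TD xT.
have N0 : area (D `\` D') = 0%E.
  have [A [mA A0 sA]] : area.-negligible
      (\big[setU/set0]_(T <- s) (elem T `\` open_elem T)).
    elim: (s) => [|T s' IH]; first by rewrite big_nil; exact: negligible_set0.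
    by rewrite big_cons; apply: negligibleU => //; exact: elem_skeleton_negligible.
  apply: (subset_measure0 (B := A)) => //; first exact: measurableD.
  move=> x [/interior_subset[T aT xT] nx]; apply: sA.
  rewrite -bigcup_seq; exists T; first by have : T \in s by rewrite sE; apply/asboolP.
  by split=> // xT'; apply: nx; rewrite D'E; exists T.
have mDD' : measurable (D `\` D' : set plane) by exact: measurableD.
rewrite (negligible_integral mDD' mD iphi N0) setDD setIidr//.
rewrite integral_bigsetU_EFin //.
- rewrite big_seq big1// => T; rewrite sE => /asboolP aT.
  have [v1 [v2 [C1 C2 uv d0]]] := uT T aT.
  exact: (integral_open_elem0 D u g phi T v1 v2 oD wg tphi (TD _ aT)).
- by apply: filter_uniq; exact: enum_uniq.
- by move=> T T' _ _ [x [xT xT']]; exact: (open_elem_disjoint T T' x).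
- by apply: measurable_int (integrableS mD mD' D'D iphi).
Qed.

End WeakDivergence.

(** * The energy argument *)

Section Energy.
Context {R : realType}.
Implicit Types (x y z : R * R) (Om A : set (R * R)).

Local Notation area := (@lebesgue_measure R \x @lebesgue_measure R)%E.
Local Notation plane := (measurableTypeR R * measurableTypeR R)%type.

(** Both local spaces consist of polynomial fields whose divergence has degree at
    most [khat]: for RT the extra summand q x is handled by [poly_on_dx_mulx],
    and for BDM differentiation lowers the degree.  The polynomial extensions
    are divergence-free on the whole plane as soon as this divergence is shown
    to vanish. *)
Lemma local_V_extend fam k A (u : R * R -> R * R) : open A ->
  local_V fam k A u ->
  exists v1 v2, [/\ Cn 1 v1, Cn 1 v2, forall x, A x -> u x = (v1 x, v2 x),
    poly_on (khat fam k) setT (fun x => dx v1 x + dy v2 x) &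
    forall x, A x -> classical_div u x = dx v1 x + dy v2 x].
Proof.
move=> oA uV.
suff [v1 [v2 [C1 C2 uv pv]]] : exists v1 v2, [/\ Cn 1 v1, Cn 1 v2,
    forall x, A x -> u x = (v1 x, v2 x) &
    poly_on (khat fam k) setT (fun x => dx v1 x + dy v2 x)].
  exists v1, v2; split=> // x Ax; rewrite /classical_div /dx /dy.
  have nA : nbhs x A by exact: open_nbhs_nbhs.
  by congr (_ + _); apply: near_eq_derive; apply: filterS nA => y Ay; rewrite uv.
case: fam uV => /= [[p1 [p2 [q 
  [/poly_on_extend[P1 pP1 E1] /poly_on_extend[P2 pP2 E2]
   /poly_on_extend[Q pQ EQ] uE]]]]|
  [/poly_on_extend[P1 pP1 E1] /poly_on_extend[P2 pP2 E2]]].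
- have CQ1 : Cn 1 (fun x => Q x * x.1) by apply: CnM; [exact: poly_on_Cn pQ|exact: Cn_fst].
  have CQ2 : Cn 1 (fun x => Q x * x.2) by apply: CnM; [exact: poly_on_Cn pQ|exact: Cn_snd].
  have CP1 : Cn 1 P1 by exact: poly_on_Cn pP1.
  have CP2 : Cn 1 P2 by exact: poly_on_Cn pP2.
  exists (fun x => P1 x + Q x * x.1), (fun x => P2 x + Q x * x.2); split.
  + exact: (CnD 1 _ _ CP1 CQ1).
  + exact: (CnD 1 _ _ CP2 CQ2).
  + by move=> x Ax; rewrite uE// E1// E2// EQ.
  + rewrite dxD// dyD//; apply: poly_onD; apply: poly_onD.
    * exact: (poly_onW _ _ _ _ (leq_pred k) (poly_on_dx _ _ pP1)).
    * exact: poly_on_dx_mulx.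
    * exact: (poly_onW _ _ _ _ (leq_pred k) (poly_on_dy _ _ pP2)).
    * exact: poly_on_dy_muly.
- exists P1, P2; split; [exact: (poly_on_Cn 1 k)|exact: (poly_on_Cn 1 k)| |].
  + by move=> x Ax; rewrite -E1// -E2// -surjective_pairing.
  + by apply: poly_onD; [exact: poly_on_dx|exact: poly_on_dy].
Qed.

(** With equal arguments each jump product is a sum of integrals of squares. *)
Lemma jump_terms_ge0 (M : mesh R) Om m tau hF (p : R * R -> R) : 0 < tau ->
  (forall e, stab_edge (M := M) Om e -> 0 < hF (edge_set e)) ->
  0 <= \sum_(e : 'I_(nelt M) * 'I_3 * 'I_(nelt M) | `[< stab_edge Om e >])
    \sum_(j < m.+1) tau * hF (edge_set e) ^+ (2 * j + 1) * jump_product e j p p.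
Proof.
move=> tau0 hF0; apply: sumr_ge0 => e /asboolP/hF0 he; apply: sumr_ge0 => j _.
apply: mulr_ge0; first by rewrite mulr_ge0 ?exprn_ge0// ltW.
rewrite /jump_product; apply: sumr_ge0 => a _; rewrite /edge_integral mulr_ge0 ?sqrtr_ge0//.
by apply: Rintegral_ge0 => t _; rewrite -expr2 sqr_ge0.
Qed.

Lemma open_negligible A : open A -> area.-negligible (A : set plane) -> A = set0.
Proof.
move=> oA [N [mN N0 AN]]; apply/seteqP; split=> // x Ax; exfalso.
have /nbhs_ballP[e /= e0 eA] := open_nbhs_nbhs (conj oA Ax).
have : area (`]x.1 - e, x.1 + e[%classic `*` `]x.2 - e, x.2 + e[%classic) = 0%E.
  apply: (subset_measure0 (B := N)) => //.
    by apply: measurableX; exact: measurable_itv.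
  move=> y [/= + +]; rewrite !in_itv/= => /andP[y1 y2] /andP[y3 y4].
  by apply/AN/eA; split; rewrite /ball/= ltr_distlC; apply/andP.
rewrite product_measure1E; try exact: measurable_itv.
have xe (r : R) : r - e < r + e by lra.
rewrite /= !lebesgue_measure_itv/= !lte_fin !xe -!EFinB -EFinM => -[] /eqP.
by rewrite mulf_eq0 => /orP[] /eqP; move: e0; clear; lra.
Qed.

(** The sets [U i] may overlap: a preimage is the union of its parts in the
    open sets [U i] and of a part in the closed set where [p] is 0. *)
Lemma measurable_piecewise (I : finType) (P : pred I) (U : I -> set (R * R))
    (d : I -> R * R -> R) (p : R * R -> R) :
  (forall i, open (U i)) -> (forall i, P i -> continuous (d i)) ->
  (forall i x, P i -> U i x -> p x = d i x) ->
  (forall x, ~ (\bigcup_(i in [set i | P i]) U i) x -> p x = 0) ->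
  measurable_fun setT (p : plane -> R).
Proof.
move=> oU cd pd p0 _ Y mY; rewrite setTI.
set V := \bigcup_(i in [set i | P i]) U i in p0.
have mV : measurable (V : set plane).
  apply: open_measurable2; exact: bigcup_open.
have -> : p @^-1` Y = (~` V `&` (cst 0 @^-1` Y)) `|`
    \bigcup_(i in [set i | P i]) (U i `&` d i @^-1` Y).
  apply/seteqP; split=> x /=.
    have [[i Pi Ui] Yx|nV Yx] := pselect (V x).
      by right; exists i => //; split=> //=; rewrite -pd.
    by left; split=> //=; rewrite -(p0 x).
  move=> [[nV]|[i Pi [Ui]]] /=; first by rewrite p0.
  by rewrite (pd i).
apply: measurableU.
  have mc : measurable_fun (~` V : set plane) (cst (0 : R) : plane -> R).
    exact: measurable_cst.
  by apply: mc => //; exact: measurableC.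
apply: fin_bigcup_measurable; first exact: finite_finset.
move=> i Pi; have mU : measurable (U i : set plane) by exact: open_measurable2.
exact: (continuous_measurable2 (d i) (U i) mU (cd i Pi) mU Y mY).
Qed.

(** A bounded measurable function with vanishing integral of its square is zero
    almost everywhere; being continuous on [U i], it is then zero at every point
    of the nonempty open set [U i `&` Om], which determines the polynomial
    [d i]. *)
Lemma piecewise_poly_eq0 (Om : set (R * R)) (I : finType) (P : pred I)
    (U : I -> set (R * R)) (d : I -> R * R -> R) (p : R * R -> R) m :
  open Om -> bounded_set Om ->
  (forall i, open (U i)) -> (forall i, P i -> poly_on m setT (d i)) ->
  (forall i x, P i -> U i x -> p x = d i x) ->
  (forall x, ~ (\bigcup_(i in [set i | P i]) U i) x -> p x = 0) ->
  (forall i, P i -> (U i `&` Om) !=set0) ->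
  \int[area]_(x in Om) (p x * p x) <= 0 ->
  forall i, P i -> forall x, d i x = 0.
Proof.
move=> oOm bOm oU pd pU p0 UOm intp.
have mOm := open_measurable2 _ oOm.
have cd i : P i -> continuous (d i).
  by move=> Pi; exact: (Cn_continuous 0 _ (poly_on_Cn 0 m _ (pd i Pi))).
have mp : measurable_fun (Om : set plane) (p : plane -> R).
  by apply: (measurable_funS measurableT) => //; exact: (measurable_piecewise I P U d).
have [B B0 OmB] := bounded_box _ bOm.
have [C HC] : exists C, forall x, Om x -> `|p x| <= C.
  have : forall i, exists C, 0 <= C /\ (P i -> forall x, box B x -> `|d i x| <= C).
    move=> i; have [Pi|nPi] := boolP (P i); last by exists 0.
    by have [C C0 HC] := continuous_bounded_box _ B (cd i Pi); exists C.
  move=> /choice[C HC]; exists (\sum_i C i) => x Omx.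
  have C0 i : 0 <= C i by case: (HC i).
  have [[i Pi Ui]|nV] := pselect ((\bigcup_(i in [set i | P i]) U i) x).
    rewrite (pU i)//; case: (HC i) => _ /(_ Pi x (OmB _ Omx)) /le_trans; apply.
    by rewrite (bigD1 i)//= lerDl sumr_ge0.
  by rewrite p0// normr0 sumr_ge0.
(* The real-valued integral is also 0 when the extended one is infinite;
     a bounded [p] on a set of finite area excludes this. *)
have aOm : (area Om < +oo)%E.
  apply: le_lt_trans (area_box_fin B); apply: le_measure => //; rewrite inE//.
  exact: measurable_box.
have ip : area.-integrable (Om : set plane) (EFin \o (fun x => p x * p x)).
  apply: measurable_bounded_integrable => //.
    exact: measurable_funM.
  exists (C * C); split; rewrite ?num_real// => K CK x Omx.
  apply: le_trans (ltW CK); rewrite normrM.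
  by apply: ler_pM => //; exact: HC.
have int0 : (\int[area]_(x in Om) `|(p x * p x)%:E| = 0)%E.
  under eq_integral do rewrite gee0_abs ?lee_fin -?expr2 ?sqr_ge0// expr2.
  rewrite -[LHS]fineK; last exact: integrable_fin_num ip.
  congr (_%:E); apply/eqP; rewrite eq_le intp /=.
  by apply: Rintegral_ge0 => x _; rewrite -expr2 sqr_ge0.
have [N [mN N0 pN]] := (ae_eq_integral_abs area mOm (measurable_int _ ip)).1 int0.
move=> i Pi; apply: (poly_on_eq0 m (d i) (U i `&` Om) (pd i Pi)).
- exact: openI.
- exact: UOm.
move=> x [Ux Omx]; apply: contrapT => dx0.
have oW : open (U i `&` Om `&` [set y | d i y != 0]).
  apply: openI; first exact: openI.
  by apply: (@open_comp _ _ (d i) [set r | r != 0]);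
    [move=> ? _; exact: cd|exact: open_neq].
have : U i `&` Om `&` [set y | d i y != 0] = set0.
  apply: open_negligible => //; exists N; split=> // y [[Uy Omy] /= dy0]; apply: pN => /=.
  move=> /(_ Omy) [] /eqP; rewrite mulf_eq0 orbb (pU i)//.
  by rewrite (negPf dy0).
move/seteqP => [/(_ x) + _]; apply; split=> //=; exact/eqP.
Qed.

End Energy.

(** * Vanishing of the divergence *)

Theorem theorem1 (R : realType) (Om Om0 : set (R * R))
  (I : Type) (Th : I -> mesh R) (h0 : R)
  (hOm : smooth_domain Om) (hOm0 : polygonal_domain Om0) (hsub : Om `<=` Om0)
  (htri : forall n, triangulation (Th n) Om0)
  (hqu : quasi_uniform Th)
  (hh0 : 0 < h0 < 1) (hh : forall n (T : 'I_(nelt (Th n))), hT T < h0)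
  (hcut : forall n, cut_condition (Th n) Om)
  (n : I) (fam : fe_family) (k : nat) (hk : admissible_order fam k)
  (tau_b : R) (htau : 0 < tau_b)
  (hF : set (R * R) -> R)
  (hFpos : forall e, stab_edge (M := Th n) Om e -> 0 < hF (edge_set e))
  (u : R * R -> R * R) (hu : Vh (Th n) Om fam k u)
  (hB : forall q, Qh (Th n) Om (khat fam k) q ->
          B0 (Th n) Om (khat fam k) tau_b hF u q = 0) :
  is_L2_div ((active_domain (Th n) Om)°) u (fun=> 0) /\
  (forall x, active_interiors (Th n) Om x -> classical_div u x = 0).
Proof.
have [ndM cfM _] := htri n.
have [oOm _ _ bOm _] := hOm.
have [[_ _ [g wg]] lV] := hu.
set p := mesh_div (Th n) Om u.
have : forall T : 'I_(nelt (Th n)), exists v : (R * R -> R) * (R * R -> R), active Om T ->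
    [/\ Cn 1 v.1, Cn 1 v.2, forall x, (elem T)° x -> u x = (v.1 x, v.2 x),
      poly_on (khat fam k) setT (fun x => dx v.1 x + dy v.2 x) &
      forall x, (elem T)° x -> classical_div u x = dx v.1 x + dy v.2 x].
  move=> T; have [aT|naT] := pselect (active Om T); last by exists (cst 0, cst 0).
  have [v1 [v2 H]] := local_V_extend fam k _ u (open_interior (elem T)) (lV T aT).
  by exists (v1, v2).
move=> /choice[v Hv].
pose d T x := dx (v T).1 x + dy (v T).2 x.
have pE T x : active Om T -> (elem T)° x -> p x = d T x.
  move=> aT xT; have [_ _ _ _ dE] := Hv T aT.
  by rewrite /p /mesh_div patchE mem_set ?dE//; exists T.
have intp : \int[(@lebesgue_measure R \x @lebesgue_measure R)%E]_(x in Om) (p x * p x) <= 0.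
  have Qp : Qh (Th n) Om (khat fam k) p.
    move=> T aT; have [_ _ _ pd _] := Hv T aT.
    apply: (poly_on_eq _ _ _ (d T)); first by move=> x; exact: pE.
    exact: (poly_on_sub _ _ setT).
  have /eqP := hB p Qp; rewrite /B0 -/p addr_eq0 => /eqP ->.
  by rewrite oppr_le0; exact: jump_terms_ge0.
have dz T : active Om T -> forall x, d T x = 0.
  move=> aT.
  apply: (piecewise_poly_eq0 Om 'I_(nelt (Th n)) (fun T => `[< active Om T >])
    (fun T => (elem T)°) d p (khat fam k)) => //.
  - by move=> T'; exact: open_interior.
  - by move=> T' /asboolP aT'; have [_ _ _ pd _] := Hv T' aT'.
  - by move=> T' x /asboolP; exact: pE.
  - move=> x nx; rewrite /p /mesh_div patchE memNset//.
    by move=> [T' aT' xT']; apply: nx; exists T' => //; exact/asboolP.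
  - move=> T' /asboolP aT'.
    have [[x [xT xOm]]|] := pselect ((elem T' `&` Om) !=set0).
      have [y [yT yOm]] := open_elem_meets T' Om x (ndM T') oOm xOm xT.
      by exists y; split=> //; exact: open_elem_interior.
    by move=> /set0P/negP/negPn/eqP E; move: aT'; rewrite /active E measure0 ltxx.
  - exact/asboolP.
split.
  apply: (weak_div_eq0 ndM cfM [set T | active Om T] u g wg) => T aT.
  have [C1 C2 uv _ _] := Hv T aT.
  exists (v T).1, (v T).2; split=> //; last exact: dz.
  by move=> x /(open_elem_interior T (ndM T)); exact: uv.
move=> x [T aT xT]; have [_ _ _ _ dE] := Hv T aT.
by rewrite dE//; exact: dz.
Qed.
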